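(* Let $\Gamma=(V,H)$ be an oriented hypergraph in which no vertex has degree zero, and let $p\ge1$. If $f$ is an eigenfunction of $\Delta_p$ for the $k$-th min-max eigenvalue $\lambda_k(\Delta_p)$, and $\lambda_k(\Delta_p)$ has multiplicity $r$, then the number of nodal domains of $f$ is at most $k+r-1$.
   Context: An oriented hypergraph $\Gamma=(V,H)$ consists of a finite vertex set $V=\{1,\dots,n\}$ and a finite set $H$ of hyperedges, each a pair $(h_{in},h_{out})$ of disjoint subsets of $V$ with nonempty union; $i\in h$ means $i\in h_{in}\cup h_{out}$. $\deg(i)$ = number of hyperedges containing $i$ (assumed $\ge1$). Let $\mathcal{I}^h(i)$ be $1$ if $i\in h_{in}$, $-1$ if $i\in h_{out}$, $0$ otherwise, and $\langle\mathcal{I}^h,f\rangle=\sum_{i\in h_{in}}f(i)-\sum_{j\in h_{out}}f(j)$. For $p>1$: $\Delta_pf(i)=\frac1{\deg(i)}\sum_{h\ni i}\mathcal{I}^h(i)|\langle\mathcal{I}^h,f\rangle|^{p-2}\langle\mathcal{I}^h,f\rangle$ (with $|0|^{p-2}\cdot0=0$), and $(\lambda,f)$, $f\ne0$, is an eigenpair if $\Delta_pf=\lambda|f|^{p-2}f$. For $p=1$: $(\lambda,f)$, $f\ne0$, is an eigenpair if there exist $z_i\in\mathrm{Sgn}(f(i))$, $z_h\in\mathrm{Sgn}(\langle\mathcal{I}^h,f\rangle)$ with $\sum_{h:\,i\in h_{in}}z_h-\sum_{h:\,i\in h_{out}}z_h=\lambda\deg(i)z_i$ for all $i$, where $\mathrm{Sgn}(t)=\{\mathrm{sign}(t)\}$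 for $t\ne0$ and $[-1,1]$ for $t=0$. $\mathrm{RQ}_p(f)=\frac{\sum_h|\langle\mathcal{I}^h,f\rangle|^p}{\sum_i\deg(i)|f(i)|^p}$. Krasnoselskii genus: for centrally symmetric $S\subseteq\mathbb{R}^n$, $\mathrm{gen}(S)$ is the least $k\ge1$ admitting an odd continuous map $S\setminus\{0\}\to\mathbb{S}^{k-1}$ ($0$ if $S\setminus\{0\}=\emptyset$); $\mathrm{Gen}_k$ = centrally symmetric sets of genus $\ge k$. The $k$-th min-max eigenvalue is $\lambda_k(\Delta_p)=\inf_{S\in\mathrm{Gen}_k}\sup_{f\in S\setminus\{0\}}\mathrm{RQ}_p(f)$. An eigenvalue $\lambda$ has multiplicity $r$ if the genus of the set of its eigenfunctions is $r$. For $f:V\to\mathbb{R}$ let $\mathrm{supp}(f)=\{i:f(i)\ne0\}$; a nodal domain of $f$ is a connected component of the hypergraph on vertex set $\mathrm{supp}(f)$ with hyperedges $(h_{in}\cap\mathrm{supp}(f),h_{out}\cap\mathrm{supp}(f))$, $h\in H$ (two vertices being connected if they are linked by a chain of such restricted hyperedges). *)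

(* Defs.v *)
From HB Require Import structures.
From mathcomp Require Import all_boot all_order all_algebra.
From mathcomp Require Import all_classical all_reals all_analysis.
Set Implicit Arguments.
Unset Strict Implicit.
Unset Printing Implicit Defensive.
Import Order.TTheory GRing.Theory Num.Theory.
Import numFieldNormedType.Exports.
Local Open Scope classical_set_scope.
Local Open Scope ring_scope.

Notation hyperedge n := ({set 'I_n} * {set 'I_n})%type.

(* A hyperedge h is the pair (h_in, h_out) = (h.1, h.2). *)
Record orhypergraph (n : nat) := OrHypergraph {
  hedges : {set hyperedge n} ;
  hedges_disjoint : forall h, h \in hedges -> h.1 :&: h.2 = finset.set0 ;
  hedges_nonempty : forall h, h \in hedges -> h.1 :|: h.2 != finset.set0
}.

Definition hdeg (n : nat) (G : orhypergraph n) (i : 'I_n) : nat :=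
  #|[set h in hedges G | i \in h.1 :|: h.2]%SET|.

(* Functions V -> R are row vectors: f(i) is [f 0 i]. *)

Definition hsign (R : realType) (n : nat) (h : hyperedge n) (i : 'I_n) : R :=
  if i \in h.1 then 1 else if i \in h.2 then -1 else 0.

Definition hpair (R : realType) (n : nat) (h : hyperedge n) (f : 'rV[R]_n) : R :=
  \sum_(i in h.1) f 0 i - \sum_(j in h.2) f 0 j.

(* t |-> |t|^(p-2) t; the product vanishes at t = 0 whatever the value of
   [0 `^ (p - 2)], which is the convention |0|^(p-2) 0 = 0. *)
Definition dualpow (R : realType) (p t : R) : R := `|t| `^ (p - 2) * t.

Definition pLaplacian (R : realType) (n : nat) (G : orhypergraph n) (p : R)
    (f : 'rV[R]_n) (i : 'I_n) : R :=
  (hdeg G i)%:R^-1 *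
    \sum_(h in hedges G | i \in h.1 :|: h.2) hsign R h i * dualpow p (hpair h f).

Definition Sgn (R : realType) (t : R) : set R :=
  if t == 0 then `[-1, 1]%classic else [set Num.sg t].

Definition eigenpair1 (R : realType) (n : nat) (G : orhypergraph n)
    (lambda : R) (f : 'rV[R]_n) : Prop :=
  f <> 0 /\
  exists (z : 'I_n -> R) (w : hyperedge n -> R),
    [/\ forall i, Sgn (f 0 i) (z i),
        forall h, h \in hedges G -> Sgn (hpair h f) (w h) &
        forall i, \sum_(h in hedges G | i \in h.1) w h
                  - \sum_(h in hedges G | i \in h.2) w h
                  = lambda * (hdeg G i)%:R * z i].

Definition eigenpair_gt1 (R : realType) (n : nat) (G : orhypergraph n) (p : R)
    (lambda : R) (f : 'rV[R]_n) : Prop :=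
  f <> 0 /\ forall i, pLaplacian G p f i = lambda * dualpow p (f 0 i).

(* Only meaningful for [1 <= p]. *)
Definition eigenpair (R : realType) (n : nat) (G : orhypergraph n) (p : R)
    (lambda : R) (f : 'rV[R]_n) : Prop :=
  if p == 1 then eigenpair1 G lambda f else eigenpair_gt1 G p lambda f.

Definition RQ (R : realType) (n : nat) (G : orhypergraph n) (p : R)
    (f : 'rV[R]_n) : R :=
  (\sum_(h in hedges G) `|hpair h f| `^ p) /
  (\sum_(i < n) (hdeg G i)%:R * `|f 0 i| `^ p).

Definition csym (R : realType) (n : nat) (S : set 'rV[R]_n) : Prop :=
  forall x, S x -> S (- x).

(* The Euclidean unit sphere S^(k-1) of R^k. *)
Definition esphere (R : realType) (k : nat) : set 'rV[R]_k :=
  [set y | \sum_(i < k) y 0 i ^+ 2 = 1].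

Definition has_odd_map (R : realType) (n : nat) (S : set 'rV[R]_n) (k : nat) : Prop :=
  exists phi : 'rV[R]_n -> 'rV[R]_k,
    [/\ {within S `\ 0, continuous phi},
        forall x, (S `\ 0) x -> phi (- x) = - phi x &
        forall x, (S `\ 0) x -> esphere (phi x)].

Definition is_least_odd_dim (R : realType) (n : nat) (S : set 'rV[R]_n) : set nat :=
  [set k | [/\ (1 <= k)%N, has_odd_map S k &
               forall j, (1 <= j)%N -> has_odd_map S j -> (k <= j)%N]].

(* The default value of [xget] is never used, see [genusP]. *)
Definition genus (R : realType) (n : nat) (S : set 'rV[R]_n) : nat :=
  if `[< S `\ 0 = set0 >] then 0%N else xget 0%N (is_least_odd_dim S).

Definition Gen (R : realType) (n k : nat) : set (set 'rV[R]_n) :=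
  [set S | csym S /\ (k <= genus S)%N].

(* Extended-real valued, as Gen_k is empty for n < k. *)
Definition minmax_eig (R : realType) (n : nat) (G : orhypergraph n) (p : R)
    (k : nat) : \bar R :=
  ereal_inf [set ereal_sup [set (RQ G p f)%:E | f in S `\ 0] | S in @Gen R n k].

Definition eigenfunctions (R : realType) (n : nat) (G : orhypergraph n)
    (p lambda : R) : set 'rV[R]_n :=
  [set f | eigenpair G p lambda f].

Definition multiplicity (R : realType) (n : nat) (G : orhypergraph n)
    (p lambda : R) : nat :=
  genus (eigenfunctions G p lambda).

Definition vsupp (R : realType) (n : nat) (f : 'rV[R]_n) : {set 'I_n} :=
  [set i | f 0 i != 0]%SET.

Definition restr_hedges (n : nat) (G : orhypergraph n) (A : {set 'I_n}) :
    {set hyperedge n} :=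
  [set (h.1 :&: A, h.2 :&: A) | h in hedges G]%SET.

Definition hadj (n : nat) (H : {set hyperedge n}) : rel 'I_n :=
  fun i j => [exists h in H, (i \in h.1 :|: h.2) && (j \in h.1 :|: h.2)].

Definition nodal_domains (R : realType) (n : nat) (G : orhypergraph n)
    (f : 'rV[R]_n) : {set {set 'I_n}} :=
  equivalence_partition
    (fingraph.connect (hadj (restr_hedges G (vsupp f)))) (vsupp f).

Lemma sumsq_gt0 (R : realType) (n : nat) (x : 'rV[R]_n) :
  x <> 0 -> 0 < \sum_(i < n) x 0 i ^+ 2.
Proof.
move=> x0; rewrite lt_neqAle sumr_ge0 ?andbT => [|i _]; last exact: sqr_ge0.
apply/eqP => /esym/eqP; rewrite psumr_eq0 => [|i _]; last exact: sqr_ge0.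
move=> /allP h; apply: x0; apply/rowP => i; rewrite mxE.
by have := h i (mem_index_enum _); rewrite sqrf_eq0 => /eqP.
Qed.

Lemma has_odd_map_normalize (R : realType) (n : nat) (S : set 'rV[R]_n) :
  has_odd_map S n.
Proof.
pose N (x : 'rV[R]_n) := Num.sqrt (\sum_(i < n) x 0 i ^+ 2).
exists (fun x => \row_j ((N x)^-1 * x 0 j)); split.
- apply: continuous_in_subspaceT => x; rewrite inE => -[_ x0].
  have N0 : N x != 0 by rewrite gt_eqF // sqrtr_gt0 sumsq_gt0.
  have cN : {for x, continuous N}.
    apply: continuous_comp; last exact: sqrt_continuous.
    have cs (s : seq 'I_n) :
        {for x, continuous (fun y : 'rV[R]_n => \sum_(i <- s) y 0 i ^+ 2)}.
      elim: s => [|i s ih].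
        rewrite (_ : (fun _ => _) = fun=> 0); first exact: cst_continuous.
        by apply/funext => y; rewrite big_nil.
      rewrite (_ : (fun _ => _) =
        fun y : 'rV[R]_n => y 0 i ^+ 2 + \sum_(j <- s) y 0 j ^+ 2); last first.
        by apply/funext => y; rewrite big_cons.
      have ci : {for x, continuous (fun y : 'rV[R]_n => y 0 i)}.
        exact: coord_continuous.
      exact: (cvgD (cvgM ci ci) ih).
    exact: cs.
  move=> A [P Pn PA].
  have : nbhs x [set y : 'rV[R]_n | forall j, P 0 j ((N y)^-1 * y 0 j)].
    apply: (@filter_forall _ _ (fun j y => P 0 j ((N y)^-1 * y 0 j)) (nbhs x)) => j.
    have c : {for x, continuous (fun y => (N y)^-1 * y 0 j)}.
      have cj : {for x, continuous (fun y : 'rV[R]_n => y 0 j)}.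
        exact: coord_continuous.
      exact: (cvgM (cvgV N0 cN) cj).
    apply: c; have := Pn 0 j; rewrite mxE; exact.
  apply: filterS => y Py; apply: PA => i j.
  by rewrite mxE (ord1 i).
- move=> x _; apply/rowP => j; rewrite !mxE.
  have -> : N (- x) = N x.
    by congr Num.sqrt; apply: eq_bigr => i _; rewrite mxE sqrrN.
  by rewrite mulrN.
- move=> x [_ x0]; rewrite /esphere /=.
  under eq_bigr do rewrite mxE exprMn.
  rewrite -mulr_sumr exprVn sqr_sqrtr ?ltW ?sumsq_gt0 //.
  by rewrite mulVf // gt_eqF // sumsq_gt0.
Qed.

Lemma genusP (R : realType) (n : nat) (S : set 'rV[R]_n) :
  S `\ 0 <> set0 -> is_least_odd_dim S (genus S).
Proof.
move=> S0; rewrite /genus; case: asboolP => // _; apply: xgetPex.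
have n0 : (0 < n)%N.
  case: n S S0 => // S S0; exfalso; apply: S0; apply/seteqP; split => // x [_ []].
  by apply/rowP => -[].
have ex : exists k, (1 <= k)%N && `[< has_odd_map S k >].
  by exists n; rewrite n0; apply/asboolP; exact: has_odd_map_normalize.
exists (ex_minn ex); case: ex_minnP => k /andP[k0 /asboolP hk] kmin.
by split=> // j j0 hj; apply: kmin; rewrite j0; apply/asboolP.
Qed.

(* Main.v *)
Require Import Defs.
From mathcomp Require Import all_boot all_order all_algebra.
From mathcomp Require Import all_classical all_reals all_analysis.
From mathcomp Require Import lra ring.
Set Implicit Arguments.
Unset Strict Implicit.
Unset Printing Implicit Defensive.
Import Order.TTheory GRing.Theory Num.Theory.
Import numFieldNormedType.Exports.

(* Let m be the number of nodal domains of f. The restrictions of f to its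
   nodal domains span an m-dimensional space on which the energy E(g) =
   sum_h |<h, g>|^p - lambda sum_i deg(i) |g(i)|^p vanishes, since a
   hyperedge meets at most one nodal domain. Near a g that is not an
   eigenfunction there is a direction along which E strictly decreases,
   uniformly in a neighbourhood: the opposite of the residual of least norm
   in the eigenvalue inclusion. Patching these directions with bump
   functions gives an odd continuous map eta with E(eta(g)) < E(g) on
   compact sets of non-eigenfunctions.
   Extend the odd map defining the genus r of the eigenfunctions to an odd
   map phi on the unit sphere of the m-dimensional space. Its zeros are not
   eigenfunctions, so eta sends them to a set with E < 0, that is RQ_p <
   lambda, whose genus j must be less than k. Extending the corresponding
   odd map to psi, the pair (phi, psi) is a nowhere vanishing odd map from
   the sphere S^(m-1) to R^(r+j), and the Borsuk-Ulam theorem gives m <= r +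
   j <= r + k - 1.
   Borsuk-Ulam itself is Ky Fan's parity count of alternating simplices,
   carried out on chains modulo 2 obtained by barycentric subdivision of the
   cross polytope; only the identity "boundary of a hemisphere = sum of two
   antipodal lower hemispheres" is needed of the triangulation. *)

(** * Chains modulo 2 and barycentric subdivision *)

Section ChainsModTwo.
Variable V : eqType.
Implicit Types (s : seq V) (c : seq (seq V)) (phi : seq V -> bool).

Fixpoint bd s : seq (seq V) :=
  if s is v :: s' then s' :: map (cons v) (bd s') else [::].

(** Chains are plain lists of simplices, and their coefficients modulo 2 are read off by pairing
    with boolean cochains. Since [ceq] compares chains only through these pairings, repeated
    simplices cancel without any rewriting of lists. *)
Definition ev phi c : bool := \big[addb/false]_(s <- c) phi s.

Definition bdc c : seq (seq V) := flatten (map bd c).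

Definition ceq c c' : Prop := forall phi, ev phi c = ev phi c'.

Lemma ev_cat phi c c' : ev phi (c ++ c') = ev phi c (+) ev phi c'.
Proof. exact: big_cat. Qed.

Lemma ev_cons phi s c : ev phi (s :: c) = phi s (+) ev phi c.
Proof. exact: big_cons. Qed.

Lemma ev_nil phi : ev phi [::] = false.
Proof. exact: big_nil. Qed.

Lemma ev_map (W : Type) (g : W -> seq V) phi (c : seq W) :
  ev phi (map g c) = \big[addb/false]_(s <- c) phi (g s).
Proof. by rewrite /ev big_map. Qed.

Lemma ev_flatten_map phi (F : seq V -> seq (seq V)) c :
  ev phi (flatten (map F c)) = ev (fun s => ev phi (F s)) c.
Proof. by rewrite /ev big_flatten big_map. Qed.

Lemma ev_addb phi psi c :
  ev (fun s => phi s (+) psi s) c = ev phi c (+) ev psi c.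
Proof. exact: big_split. Qed.

Lemma ev_bdc phi c : ev phi (bdc c) = ev (fun s => ev phi (bd s)) c.
Proof. exact: ev_flatten_map. Qed.

Lemma bdc_cat c c' : bdc (c ++ c') = bdc c ++ bdc c'.
Proof. by rewrite /bdc map_cat flatten_cat. Qed.

Lemma bdc_cone v c : ceq (bdc (map (cons v) c)) (c ++ map (cons v) (bdc c)).
Proof.
move=> phi; elim: c => [|s c ih]; first by rewrite !ev_nil.
move: ih; rewrite /bdc /= !ev_cons !ev_cat => ->.
by rewrite map_cat !ev_cat; congr (_ (+) _); rewrite addbCA.
Qed.

Lemma bdc_bd s : ceq (bdc (bd s)) [::].
Proof.
elim: s => [//|v s ih] phi /=.
rewrite [bdc _]/(bd s ++ bdc (map (cons v) (bd s))) ev_cat bdc_cone ev_cat.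
by rewrite ev_map -/(ev (fun t => phi (v :: t)) _) ih !ev_nil addbF addbb.
Qed.

Lemma size_bd s t : t \in bd s -> (size t).+1 = size s.
Proof.
elim: s t => [//|v s ih] t; rewrite /= inE => /predU1P[-> //|].
by move=> /mapP[u /ih /= <- ->].
Qed.

Lemma bd_subset s t : t \in bd s -> {subset t <= s}.
Proof.
elim: s t => [//|v s ih] t; rewrite /= inE => /predU1P[->|].
  by move=> x xs; rewrite inE xs orbT.
move=> /mapP[u /ih us ->] x; rewrite !inE => /orP[->//|/us ->].
by rewrite orbT.
Qed.

Lemma eq_in_ev phi psi c : {in c, phi =1 psi} -> ev phi c = ev psi c.
Proof. by move=> e; apply: eq_big_seq. Qed.

End ChainsModTwo.

Lemma bd_map (V W : eqType) (g : V -> W) s : bd (map g s) = map (map g) (bd s).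
Proof.
elim: s => [//|v s ih] /=; congr (_ :: _).
by rewrite ih -!map_comp; apply: eq_map.
Qed.

(** * Barycentric subdivision as a chain map *)

Section Subdivision.
Variables (V : eqType) (bary : seq V -> V) (neg : V -> V).
Hypothesis bary_neg : forall s, bary (map neg s) = neg (bary s).
Hypothesis bary1 : forall v, bary [:: v] = v.
Implicit Types (s t : seq V) (c : seq (seq V)).

(* [sd n] subdivides simplices with [n] vertices. *)
Fixpoint sd n s : seq (seq V) :=
  if n is n'.+1 then map (cons (bary s)) (flatten (map (sd n') (bd s)))
  else [:: s].

Definition sdc n c := flatten (map (sd n) c).

Definition negc c := map (map neg) c.

Lemma sdS n s : sd n.+1 s = map (cons (bary s)) (sdc n (bd s)).
Proof. by []. Qed.

Lemma sdP n s t : t \in sd n.+1 s ->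
  exists u t', [/\ u \in bd s, t' \in sd n u & t = bary s :: t'].
Proof. by move=> /mapP[t' /flatten_mapP[u us t'u] ->]; exists u, t'. Qed.

Lemma size_sd n s t : size s = n -> t \in sd n s -> size t = n.
Proof.
elim: n s t => [|n ih] s t sn; first by rewrite inE => /eqP ->.
move=> /sdP[u [t' [us t'u ->]]] /=; congr _.+1; apply: ih t'u.
by have := size_bd us; rewrite sn => -[].
Qed.

Lemma sd_neg n s : sd n (map neg s) = negc (sd n s).
Proof.
elim: n s => [//|n ih] s /=.
have negc_cone v c : negc (map (cons v) c) = map (cons (neg v)) (negc c).
  by rewrite /negc -!map_comp.
rewrite bary_neg bd_map negc_cone; congr [seq _ :: i | i <- _].
rewrite /negc map_flatten -!map_comp; congr flatten.
by apply: eq_map => u /=; rewrite ih.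
Qed.

Lemma sdc_neg n c : sdc n (negc c) = negc (sdc n c).
Proof.
rewrite /sdc /negc -map_comp map_flatten -map_comp; congr flatten.
by apply: eq_map => s /=; rewrite sd_neg.
Qed.

Lemma sdc_cat n c c' : sdc n (c ++ c') = sdc n c ++ sdc n c'.
Proof. by rewrite /sdc map_cat flatten_cat. Qed.

Lemma ev_sdc phi n c : ev phi (sdc n c) = ev (fun s => ev phi (sd n s)) c.
Proof. exact: ev_flatten_map. Qed.

Lemma ceq_sdc n c c' : ceq c c' -> ceq (sdc n c) (sdc n c').
Proof. by move=> e phi; rewrite !ev_sdc. Qed.

(** A subdivided simplex is the cone from [bary s] over its subdivided boundary. The boundary of the
    cone is its base plus the cone over the boundary of the base; by induction the latter subdivides
    [bdc (bd s)], which vanishes modulo 2. *)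
Lemma bdc_sdc n c : {in c, forall s, size s = n.+1} ->
  ceq (bdc (sdc n.+1 c)) (sdc n (bdc c)).
Proof.
elim: n c => [|n ih] c sz phi; rewrite ev_bdc !ev_sdc ev_bdc;
    apply: eq_in_ev => s sc; rewrite -[RHS]ev_sdc -ev_bdc sdS bdc_cone ev_cat.
  rewrite [X in _ (+) X]ev_map [X in _ (+) X]big1_seq ?addbF // => t.
  case: s sc (sz _ sc) => [|v [|]] //=.
rewrite [X in _ (+) X]ev_map -/(ev (fun t => phi (_ :: t)) _) ih; last first.
  by move=> t /size_bd; rewrite (sz _ sc) => -[].
by rewrite [X in _ (+) X]ev_sdc bdc_bd ev_nil addbF.
Qed.

End Subdivision.

(** * Hemispheres of the octahedral sphere *)

Section Octahedron.
Variables (V : eqType) (neg : V -> V) (e : nat -> V).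
Hypothesis negK : involutive neg.

(* The cone with apex [e j] over the (j-1)-dimensional octahedral sphere: half
   of the j-dimensional one. *)
Fixpoint oct j : seq (seq V) :=
  if j is j'.+1 then map (cons (e j)) (oct j' ++ negc neg (oct j'))
  else [:: [:: e 0]].

Lemma negcK c : negc neg (negc neg c) = c.
Proof.
rewrite /negc -map_comp -[RHS]map_id; apply: eq_map => s /=.
by rewrite -map_comp -[RHS]map_id; apply: eq_map.
Qed.

Lemma ev_negc phi c : ev phi (negc neg c) = ev (fun s => phi (map neg s)) c.
Proof. exact: ev_map. Qed.

Lemma bdc_negc c : bdc (negc neg c) = negc neg (bdc c).
Proof.
rewrite /bdc /negc -map_comp map_flatten -map_comp; congr flatten.
by apply: eq_map => s /=; rewrite bd_map.
Qed.

Lemma negc_cat c c' : negc neg (c ++ c') = negc neg c ++ negc neg c'.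
Proof. exact: map_cat. Qed.

(** The base of the cone is a cycle: by induction its two halves have the same antipodally symmetric
    boundary, and these cancel. Only the base itself is left. *)
Lemma bdc_oct j : ceq (bdc (oct j.+1)) (oct j ++ negc neg (oct j)).
Proof.
elim: j => [|j ih] phi.
  rewrite /bdc /= !ev_cons !ev_nil.
  by case: (phi [:: e 0]); case: (phi [:: e 1]); case: (phi [:: neg _]).
rewrite [oct j.+2]/(map _ (oct j.+1 ++ _)) bdc_cone [LHS]ev_cat.
rewrite [X in _ (+) X]ev_map -/(ev (fun t => phi (_ :: t)) _).
move: (fun t => _) => psi.
rewrite [X in _ (+) X](_ : _ = false) ?addbF // bdc_cat bdc_negc ev_cat ev_negc.
by rewrite !ih -ev_negc negc_cat negcK !ev_cat [X in _ (+) X]addbC addbb.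
Qed.

Lemma size_oct j s : s \in oct j -> size s = j.+1.
Proof.
elim: j s => [|j ih] s /=; first by rewrite inE => /eqP ->.
move=> /mapP[t + ->]; rewrite mem_cat => /orP[/ih /= ->//|].
by move=> /mapP[u /ih /= <- ->]; rewrite size_map.
Qed.

Variable bary : seq V -> V.
Hypothesis bary_neg : forall s, bary (map neg s) = neg (bary s).
Hypothesis bary1 : forall v, bary [:: v] = v.

Definition octsd N j : seq (seq V) := iter N (sdc bary j.+1) (oct j).

Lemma size_octsd N j s : s \in octsd N j -> size s = j.+1.
Proof.
elim: N s => [|N ih] s; first exact: size_oct.
by move=> /flatten_mapP[t /ih tj /(size_sd tj)].
Qed.

(** The identity [bdc_oct] survives subdivision, which commutes with the boundary by [bdc_sdc] and
    with the antipode by [sdc_neg]. *)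
Lemma bdc_octsd N j :
  ceq (bdc (octsd N j.+1)) (octsd N j ++ negc neg (octsd N j)).
Proof.
elim: N => [|N ih] phi; first exact: bdc_oct.
rewrite /octsd !iterS -/(octsd N _) bdc_sdc; last exact: size_octsd.
by rewrite (ceq_sdc bary j.+1 ih) sdc_cat sdc_neg.
Qed.

Lemma octsd0 N : octsd N 0 = [:: [:: e 0]].
Proof.
elim: N => [//|N]; rewrite /octsd iterS -/(octsd N 0) => ->.
by rewrite /sdc /= bary1.
Qed.

End Octahedron.

(** * Ky Fan's lemma *)

(* A signed label [(i, b)] is encoded as the natural number [i.*2 + b]. *)
Definition flip (a : nat) : nat := a./2.*2 + ~~ odd a.

Definition nocompl (L : seq nat) : Prop :=
  {in L &, forall a b, a./2 = b./2 -> a = b}.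

Fixpoint altern (b : bool) (u : seq bool) : bool :=
  if u is x :: u' then (x == b) && altern (~~ b) u' else true.

(** Sorting the codes orders the labels by absolute value [a./2], and [odd] reads their signs; these
    must alternate, starting with [true]. *)
Definition alt (L : seq nat) : bool := altern true (map odd (sort leq L)).

Lemma odd_flip a : odd (flip a) = ~~ odd a.
Proof. by rewrite /flip oddD odd_double; case: (odd a). Qed.

(** A nonempty word alternating from [b] still does so only after losing its last sign; one
    alternating from [~~ b] starts with [b] only after losing its first. Any other word has no good
    deletion, or exactly two: either member of its one pair of equal neighbours. *)
Lemma ev_altern b u :
  ev (altern b) (bd u) = altern b u (+) altern (~~ b) u.
Proof.
elim: u b => [|x u ih] b; first by rewrite ev_nil.
rewrite /= ev_cons ev_map /= -big_distrr /= -/(ev _ _) ih negbK.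
by case: x; case: b => /=; case: (altern true u); case: (altern false u).
Qed.

Lemma altern_negb b u : altern b (map negb u) = altern (~~ b) u.
Proof. by elim: u b => [//|x u ih] b /=; rewrite ih; case: x; case: b. Qed.

Lemma ev_perm_invariant (T : eqType) (phi : seq T -> bool) L :
  (forall s t, perm_eq s t -> phi s = phi t) ->
  ev phi (bd L) = \big[addb/false]_(x <- L) phi (rem x L).
Proof.
elim: L phi => [|x L ih] phi phiP; first by rewrite ev_nil big_nil.
rewrite /= ev_cons big_cons eqxx; congr (_ (+) _).
rewrite ev_map -/(ev (fun t => phi (x :: t)) _) ih; last first.
  by move=> s t st; apply: phiP; rewrite perm_cons.
apply: eq_big_seq => y yL; apply: phiP.
by case: eqVneq => // ->; rewrite perm_sym perm_to_rem.
Qed.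

Lemma perm_alt s t : perm_eq s t -> alt s = alt t.
Proof.
by move=> /(perm_sortP leq_total leq_trans anti_leq); rewrite /alt => ->.
Qed.

(** As [alt] ignores the order of the labels, the facets of [L] may be replaced by those of its
    sorted form, which are themselves sorted; then [ev_altern] does the count. *)
Lemma ev_alt_bd L :
  ev alt (bd L) = alt L (+) altern false (map odd (sort leq L)).
Proof.
rewrite ev_perm_invariant; last exact: perm_alt.
have pL : perm_eq L (sort leq L) by rewrite perm_sym perm_sort.
rewrite (perm_big _ pL) /=.
transitivity (\big[addb/false]_(x <- sort leq L) alt (rem x (sort leq L))).
  apply: eq_big_seq => x xM; apply: perm_alt; rewrite -(perm_cons x).
  rewrite -(permPl (perm_to_rem _)) ?(perm_mem pL) //.
  by rewrite -(permPr (perm_to_rem xM)).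
rewrite -ev_perm_invariant; last exact: perm_alt.
have : sorted leq (sort leq L) by apply: sort_sorted; exact: leq_total.
rewrite [alt L]/(altern true (map odd (sort leq L))).
move: (sort leq L) {pL} => M sM.
transitivity (ev (altern true) (map (map odd) (bd M))); last first.
  by rewrite -bd_map ev_altern.
rewrite ev_map; apply: eq_big_seq => t tM.
rewrite /alt sorted_sort //; first exact: leq_trans.
suff : subseq t M by move=> /(subseq_sorted leq_trans); apply.
elim: M t tM {sM} => [//|v M ih] t; rewrite /= inE => /predU1P[->|].
  exact: subseq_cons.
by move=> /mapP[t' /ih st ->]; rewrite eqxx.
Qed.

(** Labels with the same absolute value are equal here, so [flip] preserves their order and commutes
    with sorting; only the signs are negated. *)
Lemma alt_flip L : nocompl L ->
  alt (map flip L) = altern false (map odd (sort leq L)).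
Proof.
move=> ncL; rewrite /alt.
have -> : sort leq (map flip L) = map flip (sort leq L).
  apply: (@sorted_eq _ leq leq_trans anti_leq).
  - by apply: sort_sorted; exact: leq_total.
  - have : nocompl (sort leq L) by move=> a b; rewrite !mem_sort; exact: ncL.
    have : sorted leq (sort leq L) by apply: sort_sorted; exact: leq_total.
    elim: (sort leq L) => [//|a [//|b M] ih] /= /andP[ab sM] nc.
    apply/andP; split; last first.
      by apply: ih => // x y xM yM; apply: nc; rewrite inE ?xM ?yM orbT.
    have [/nc|ne] := eqVneq a./2 b./2.
      by move=> ->; rewrite ?inE ?eqxx ?orbT.
    have lt : a./2 < b./2 by rewrite ltn_neqAle ne half_leq.
    rewrite /flip (@leq_trans (a./2.*2 + 1)) //.
      by rewrite leq_add2l; case: (odd a).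
    by rewrite (@leq_trans b./2.*2) ?leq_addr // addn1 ltn_double.
  - by rewrite perm_sort; apply: perm_map; rewrite perm_sym perm_sort.
rewrite -map_comp (eq_map (odd_flip : odd \o flip =1 negb \o odd)).
by rewrite map_comp altern_negb.
Qed.

(** Alternation excludes equal labels and [nocompl] excludes opposite ones, so the absolute values
    are distinct numbers below [d]. *)
Lemma altern_size b L d : nocompl L -> {in L, forall a, a < d.*2} ->
  altern b (map odd (sort leq L)) -> size L <= d.
Proof.
move=> ncL ltL; rewrite -(size_sort leq).
have : nocompl (sort leq L) by move=> x y; rewrite !mem_sort; exact: ncL.
have : {in sort leq L, forall a, a < d.*2}.
  by move=> x; rewrite mem_sort; exact: ltL.
have : sorted leq (sort leq L) by apply: sort_sorted; exact: leq_total.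
move: (sort leq L) => M {ncL ltL} sM ltM ncM aM.
have uM : uniq (map half M).
  have: sorted ltn (map half M).
    elim: M b sM ncM aM {ltM} => [//|x [//|y M] ih] b /= /andP[xy sM] nc.
    case/and3P => /eqP xb /eqP yb aM; apply/andP; split; last first.
      apply: (ih (~~ b)) => //=; last by rewrite yb eqxx.
      by move=> u v uM vM; apply: nc; rewrite inE ?uM ?vM orbT.
    rewrite ltn_neqAle half_leq // andbT; apply/eqP => e.
    have xy' : x = y by apply: nc; rewrite ?inE ?eqxx ?orbT.
    by move: xb; rewrite xy' yb; case: b {ih yb aM}.
  by apply: sorted_uniq; [exact: ltn_trans|exact: ltnn].
rewrite -(size_map half) -(size_iota 0 d); apply: (uniq_leq_size uM).
move=> _ /mapP[x /ltM xd ->]; rewrite mem_iota /=.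
by rewrite -ltn_double (leq_ltn_trans _ xd) // -{2}(odd_double_half x) leq_addl.
Qed.

Section Fan.
Variables (V : eqType) (neg : V -> V) (X : nat -> seq (seq V)) (v0 : V).
Hypothesis X0 : X 0 = [:: [:: v0]].
Hypothesis sizeX : forall j s, s \in X j -> size s = j.+1.
Hypothesis bdX : forall j, ceq (bdc (X j.+1)) (X j ++ negc neg (X j)).
Variables (d : nat) (ell : V -> nat).
Hypothesis ell_neg : forall j s v, j <= d -> s \in X j -> v \in s ->
  ell (neg v) = flip (ell v).
Hypothesis ell_lt : forall j s v, j <= d -> s \in X j -> v \in s ->
  ell v < d.*2.
Hypothesis ell_nocompl : forall j s, j <= d -> s \in X j ->
  nocompl (map ell s).

Lemma alt_ell_neg j s : j <= d -> s \in X j ->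
  alt (map ell (map neg s)) = altern false (map odd (sort leq (map ell s))).
Proof.
move=> jd sX; rewrite -map_comp -alt_flip; last exact: ell_nocompl jd sX.
rewrite -map_comp; congr alt; apply/eq_in_map => v vs /=.
exact: ell_neg jd sX vs.
Qed.

(* Ky Fan's count: the number of alternating simplices, of either sign, of
   [X j] does not depend on [j] modulo 2. *)
Lemma fan_parity j : j <= d ->
  ev (fun s => alt (map ell s) (+) alt (map ell (map neg s))) (X j).
Proof.
elim: j => [|j ih] jd.
  rewrite ev_addb X0 !ev_cons !ev_nil !addbF.
  have v0X : [:: v0] \in X 0 by rewrite X0 mem_head.
  rewrite (alt_ell_neg jd v0X) /alt /=.
  by case: (odd _).
(* By [ev_alt_bd] the two signs at [s] together count its alternating facets. Summed over [X j.+1],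
   this pairs with the boundary, a sphere made of [X j] and its antipode. *)
have -> : ev (fun s => alt (map ell s) (+) alt (map ell (map neg s))) (X j.+1)
    = ev (fun s => ev (fun t => alt (map ell t)) (bd s)) (X j.+1).
  apply: eq_in_ev => s sX; rewrite (alt_ell_neg jd sX) -ev_alt_bd bd_map.
  by rewrite ev_map.
rewrite -ev_bdc bdX ev_cat ev_negc -ev_addb; apply: ih; exact: ltnW.
Qed.

(** An alternating simplex of [X d] would need [d.+1] distinct absolute values below [d]. So the
    count is zero, while [fan_parity] makes it odd. *)
Lemma fan_contradiction : False.
Proof.
have := fan_parity (leqnn d).
set phi := (fun s => _); suff -> : ev phi (X d) = ev xpred0 (X d).
  by rewrite /ev big1.
apply: eq_in_ev => s sX; rewrite /phi.
have no b : altern b (map odd (sort leq (map ell s))) = false.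
  apply/negP => /(@altern_size _ _ d); rewrite size_map (sizeX sX) ltnn => H.
  suff: false by []. apply: H; first exact: ell_nocompl sX.
  by move=> _ /mapP[v vs ->]; exact: ell_lt sX vs.
by rewrite (alt_ell_neg (leqnn d) sX) /alt !no.
Qed.

End Fan.

Local Open Scope classical_set_scope.
Local Open Scope ring_scope.

(** * The Borsuk-Ulam theorem *)

Section Barycentric.
Variables (R : realType) (V : normedModType R).
Implicit Types (s t : seq V).

Definition bary s : V := (size s)%:R^-1 *: \sum_(v <- s) v.

Lemma bary_opp s : bary (map -%R s) = - bary s.
Proof. by rewrite /bary size_map big_map sumrN scalerN. Qed.

Lemma bary1 v : bary [:: v] = v.
Proof. by rewrite /bary big_seq1 invr1 scale1r. Qed.

Definition mean_closed (P : V -> Prop) : Prop :=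
  forall s, s != [::] -> {in s, forall v, P v} -> P (bary s).

Lemma sd_mean_closed (P : V -> Prop) n s t : mean_closed P -> size s = n ->
  {in s, forall v, P v} -> t \in sd bary n s -> {in t, forall v, P v}.
Proof.
move=> mP; elim: n s t => [|n ih] s t sn sP; first by rewrite inE => /eqP ->.
move=> /sdP[u [t' [us t'u ->]]] v; rewrite inE => /predU1P[->|vt'].
  by apply: mP => //; rewrite -size_eq0 sn.
apply: (ih u t') => //; first by have := size_bd us; rewrite sn => -[].
by move=> w wu; apply: sP; apply: bd_subset wu.
Qed.

Lemma sub_bary s c : s != [::] ->
  c - bary s = (size s)%:R^-1 *: \sum_(v <- s) (c - v).
Proof.
rewrite -size_eq0 => s0; rewrite sumrB big_const_seq count_predT iter_addr addr0.
by rewrite scalerBr -[c *+ _]scaler_nat scalerA mulVf ?pnatr_eq0 // scale1r.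
Qed.

Lemma mean_closed_ball (c : V) (r : R) : mean_closed (fun y => `|c - y| <= r).
Proof.
move=> s s0 sr; rewrite sub_bary // normrZ ger0_norm ?invr_ge0 //.
have sz : 0 < (size s)%:R :> R by rewrite ltr0n lt0n size_eq0.
rewrite mulrC ler_pdivrMr // mulr_natr (le_trans (ler_norm_sum _ _ _)) //.
rewrite big_seq (le_trans (ler_sum _ (G := fun=> r) _)) //.
by rewrite -big_seq big_const_seq count_predT iter_addr addr0.
Qed.

(** For a vertex [v] of [s], the difference [v - bary s] is a mean of [n.+1] differences one of
    which is zero, whence the factor [n / n.+1], at most [d / d.+1]. The ball around [bary s] then
    contains the subdivided facet by convexity; pairs inside that facet fall under the induction. *)
Lemma sd_diameter (r : R) d n s t : 0 <= r -> (n <= d.+1)%N -> size s = n ->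
  {in s &, forall x y, `|x - y| <= r} -> t \in sd bary n s ->
  {in t &, forall x y, `|x - y| <= d%:R / d.+1%:R * r}.
Proof.
move=> r0; elim: n s t => [|n ih] s t nd sn sr.
  by move/size0nil: sn => ->; rewrite inE => /eqP -> x.
have kr : 0 <= d%:R / d.+1%:R * r :> R by rewrite mulr_ge0 // divr_ge0.
move=> tsd; case/sdP: (tsd) => [u [t' [us t'u tE]]].
have s0 : s != [::] by rewrite -size_eq0 sn.
have bt' y : y \in t' -> `|bary s - y| <= d%:R / d.+1%:R * r.
  move=> yt'.
  have : size u = n by have := size_bd us; rewrite sn => -[].
  move=> un; apply: (@sd_mean_closed (fun y => `|bary s - y| <= _) n u t'
    (@mean_closed_ball _ _) un _ t'u y yt').
  move=> v /(bd_subset us) vs.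
  rewrite distrC sub_bary // (big_rem v) //= subrr add0r.
  rewrite normrZ ger0_norm ?invr_ge0 // sn.
  have : `|\sum_(w <- rem v s) (v - w)| <= n%:R * r.
    rewrite (le_trans (ler_norm_sum _ _ _)) //.
    rewrite big_seq (le_trans (ler_sum _ (G := fun=> r) _)) //.
      by move=> w /mem_rem ws; exact: sr.
    rewrite -big_seq big_const_seq count_predT iter_addr addr0 size_rem //.
    by rewrite sn mulr_natl.
  rewrite [_^-1 * _]mulrC ler_pdivrMr ?ltr0n // => /le_trans; apply.
  rewrite mulrAC ler_wpM2r // mulrAC ler_pdivlMr ?ltr0n //.
  by rewrite -!natrM ler_nat !mulnS [(n * d)%N]mulnC leq_add2r.
rewrite tE => x y; rewrite !inE => /predU1P[->|xt] /predU1P[->|yt].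
- by rewrite subrr normr0.
- exact: bt'.
- by rewrite distrC; exact: bt'.
- apply: (ih u t') => //; first exact: ltnW.
    by have := size_bd us; rewrite sn => -[].
  by move=> a b /(bd_subset us) ? /(bd_subset us) ?; exact: sr.
Qed.

End Barycentric.

(** * The cross polytope and its subdivisions *)

Section CrossPolytope.
Variables (R : realType) (m : nat).
Local Notation V := 'rV[R]_m.

Definition cross_sphere : set V := [set x | \sum_i `|x 0 i| = 1].

Definition cross_vertex (i : nat) : V := \row_k (k == i :> nat)%:R.

(** For signs [sg], the facet of the cross polytope in the corresponding orthant. Unlike
    [cross_sphere] it is convex, so subdivision does not leave it. *)
Definition cross_face (sg : nat -> R) (x : V) : Prop :=
  (forall i : 'I_m, 0 <= sg i * x 0 i) /\ \sum_(i < m) sg i * x 0 i = 1.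

Lemma mean_closed_face sg : mean_closed (cross_face sg).
Proof.
move=> s s0 sP; have sz : (size s)%:R != 0 :> R by rewrite pnatr_eq0 size_eq0.
have bE (i : 'I_m) : sg i * bary s 0 i =
    (size s)%:R^-1 * \sum_(v <- s) sg i * v 0 i.
  by rewrite mxE summxE mulrCA mulr_sumr.
split=> [i|].
  rewrite bE mulr_ge0 ?invr_ge0 // big_seq sumr_ge0 // => v vs.
  by have [] := sP v vs.
under eq_bigr do rewrite bE; rewrite -mulr_sumr exchange_big /=.
rewrite big_seq (eq_bigr (fun=> 1)); last by move=> v vs; have [] := sP v vs.
by rewrite -big_seq big_const_seq count_predT iter_addr addr0 mulVf.
Qed.

Lemma cross_face_sphere sg x : (forall i, `|sg i| = 1) -> cross_face sg x ->
  cross_sphere x.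
Proof.
move=> s1 [x0 x1]; rewrite /cross_sphere /= -[RHS]x1; apply: eq_bigr => i _.
by rewrite -[RHS]ger0_norm // normrM s1 mul1r.
Qed.

Lemma cross_sphereN x : cross_sphere x -> cross_sphere (- x).
Proof.
by rewrite /cross_sphere /= => <-; apply: eq_bigr => i _; rewrite mxE normrN.
Qed.

Lemma oct_cross_face j s : (j < m)%N ->
  s \in oct (-%R : V -> V) cross_vertex j ->
  exists sg : nat -> R,
    (forall i, `|sg i| = 1) /\ {in s, forall v, cross_face sg v}.
Proof.
move=> jm.
(* Strengthened for the induction: the vertices of a simplex are signed unit vectors of index at
   most [j], which leaves the sign of the next apex free. *)
suff H : s \in oct (-%R : V -> V) cross_vertex j ->
    exists sg : nat -> R, (forall i, `|sg i| = 1) /\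
    {in s, forall v, exists2 i : nat, (i <= j)%N & v = sg i *: cross_vertex i}.
  move=> /H[sg [s1 sP]]; exists sg; split=> // _ /sP[i ij ->].
  have im : (i < m)%N by exact: leq_ltn_trans jm.
  have ss : sg i * sg i = 1.
    by rewrite -expr2 -real_normK ?num_real // s1 expr1n.
  split=> [k|].
    rewrite !mxE; case: eqVneq => [->|_]; last by rewrite !mulr0.
    by rewrite mulr1 ss.
  rewrite (bigD1 (Ordinal im)) //= !mxE eqxx mulr1 ss big1 ?addr0 // => k ki.
  by rewrite !mxE (_ : (_ == _) = false) ?mulr0 //; exact: negbTE.
elim: j s {jm} => [|j ih] s /=.
  rewrite inE => /eqP ->; exists (fun=> 1); split=> [i|v]; first exact: normr1.
  by rewrite inE => /eqP ->; exists 0%N; rewrite // scale1r.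
case/mapP => t tO ->.
suff [sg [s1 sP]] : exists sg : nat -> R, (forall i, `|sg i| = 1) /\
    {in t, forall v, exists2 i : nat, (i <= j)%N & v = sg i *: cross_vertex i}.
  exists (fun i => if i == j.+1 then 1 else sg i); split=> [i|v].
    by case: ifP => // _; exact: normr1.
  rewrite inE => /predU1P[->|/sP[i ij ->]].
    by exists j.+1; rewrite // eqxx scale1r.
  by exists i; [exact: ltnW|rewrite ltn_eqF].
move: tO; rewrite mem_cat => /orP[/ih //|/mapP[u /ih[sg [s1 sP]] ->]].
exists (fun i => - sg i); split=> [i|_ /mapP[v /sP[i ij ->] ->]].
  by rewrite normrN.
by exists i; rewrite // scaleNr.
Qed.

Lemma octsd_cross N j s : (j < m)%N ->
  s \in octsd -%R cross_vertex (@bary R V) N j ->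
  exists sg : nat -> R,
    (forall i, `|sg i| = 1) /\ {in s, forall v, cross_face sg v}.
Proof.
move=> jm; elim: N s => [|N ih] s; first exact: oct_cross_face.
move=> /flatten_mapP[t tN st]; have [sg [s1 sP]] := ih t tN.
exists sg; split => //; apply: sd_mean_closed st => //.
  exact: mean_closed_face.
exact: size_octsd tN.
Qed.

Lemma ler_mx_norm_coord (x : V) i : `|x 0 i| <= `|x|.
Proof.
rewrite /Num.norm/= mx_normrE (le_trans _ (le_bigmax _ _ (0, i)))//.
Qed.

Lemma mx_norm_le (x : V) (r : R) :
  0 <= r -> (forall i, `|x 0 i| <= r) -> `|x| <= r.
Proof.
move=> r0 xr; rewrite /Num.norm/= mx_normrE; apply: bigmax_le => // -[i j] _ /=.
by rewrite ord1.
Qed.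

Lemma mx_norm_lt (x : V) (r : R) :
  0 < r -> (forall i, `|x 0 i| < r) -> `|x| < r.
Proof.
move=> r0 xr; rewrite /Num.norm/= mx_normrE; apply: bigmax_lt => // -[i j] _ /=.
by rewrite ord1.
Qed.

Lemma cross_sphere_norm x : cross_sphere x -> `|x| <= 1.
Proof.
move=> x1; apply: mx_norm_le => // i; rewrite -x1 (bigD1 i) //= lerDl sumr_ge0 //.
Qed.

Lemma octsd_diameter N j s : (j < m)%N ->
  s \in octsd -%R cross_vertex (@bary R V) N j ->
  {in s &, forall x y, `|x - y| <= (j%:R / j.+1%:R) ^+ N * 2}.
Proof.
move=> jm; elim: N s => [|N ih] s.
  move=> /(oct_cross_face jm)[sg [s1 sP]] x y xs ys; rewrite mul1r.
  rewrite (le_trans (ler_normB _ _)) // -[2]/(1 + 1) lerD //;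
  by apply: cross_sphere_norm; apply: (@cross_face_sphere sg); auto.
move=> /flatten_mapP[t tN st]; rewrite exprS -mulrA.
apply: (@sd_diameter R _ ((j%:R / j.+1%:R) ^+ N * 2) j j.+1 t s) => //.
- exact: size_octsd tN.
- exact: ih.
Qed.

End CrossPolytope.


Section BorsukUlam.
Variable R : realType.

Lemma continuous_rV (T : topologicalType) n (F : T -> 'rV[R]_n) :
  (forall i, continuous (fun x => F x 0 i)) -> continuous F.
Proof.
move=> cF x A [P Pn PA].
have : nbhs x [set y | forall j, P 0 j (F y 0 j)].
  apply: (@filter_forall _ _ (fun j y => P 0 j (F y 0 j)) (nbhs x)) => j.
  by apply: cF; exact: Pn.
by apply: filterS => y Py; apply: PA => i j; rewrite (ord1 i).
Qed.

Lemma continuous_sumr (T : topologicalType) (I : Type) (r : seq I) (P : pred I)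
    (F : I -> T -> R) :
  (forall i, continuous (F i)) ->
  continuous (fun x => \sum_(i <- r | P i) F i x).
Proof.
move=> cF; elim: r => [|i r ih].
  rewrite (_ : (fun _ => _) = fun=> 0); first exact: cst_continuous.
  by apply/funext => x; rewrite big_nil.
rewrite (_ : (fun _ => _) = fun x =>
    (if P i then F i x else 0) + \sum_(j <- r | P j) F j x); last first.
  by apply/funext => x; rewrite big_cons; case: (P i); rewrite ?add0r.
move=> x; apply: cvgD; last exact: ih.
by case: (P i); [exact: cF|exact: cvg_cst].
Qed.

Lemma coord_continuousr m (i : 'I_m) : continuous (fun x : 'rV[R]_m => x 0 i).
Proof. exact: coord_continuous. Qed.

Lemma cross_sphere_compact m : compact (@cross_sphere R m).
Proof.
apply: bounded_closed_compact.
  exists 1; split; first exact: num_real.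
  move=> M M1 x /cross_sphere_norm x1; exact: (le_trans x1 (ltW M1)).
apply: (@preimage_closed _ _ (fun x : 'rV[R]_m => \sum_i `|x 0 i|) [set 1]).
  move=> x _; apply: continuous_sumr => i {}x.
  apply: continuous_comp; first exact: coord_continuousr.
  exact: norm_continuous.
exact: closed_eq.
Qed.

Lemma compact_uniform_continuity (U V : normedModType R) (A : set U)
    (g : U -> V) (d : R) : compact A -> continuous g -> 0 < d ->
  exists2 e : R, 0 < e & forall x y, A x -> `|x - y| < e -> `|g x - g y| < d.
Proof.
move=> /compact_near_coveringP cA cg d0.
have := @cA R 0^'+ (fun e x => forall y, `|x - y| < e -> `|g x - g y| < d) _.
case=> [x Ax|e /= e0 H].
  have /cvgrPdist_lt/(_ (d / 2)) := cg x.
  rewrite divr_gt0 // => /(_ isT) /nbhs_ballP[e /= e0 xe].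
  exists (ball x (e / 2), [set t | t < e / 2]).
    split; first by apply: nbhsx_ballx; rewrite divr_gt0.
    by apply: nbhs_right_lt; rewrite divr_gt0.
  move=> [z t] /= []; rewrite -ball_normE /= => xz te y zy.
  have xy : `|x - y| < e.
    rewrite -(subrKA z) (le_lt_trans (ler_normD _ _)) // [e]splitr.
    by rewrite ltrD // (lt_trans zy).
  rewrite -(subrKA (g x)) (le_lt_trans (ler_normD _ _)) // [d]splitr ltrD //.
    rewrite distrC; apply: xe; rewrite -ball_normE /= (lt_trans xz) //.
    by rewrite ltr_pdivrMr // ltr_pMr // ltr1n.
  by apply: xe; rewrite -ball_normE.
exists (e / 2); first by rewrite divr_gt0.
move=> x y Ax xy; apply: (H (e / 2)) => //=; last by rewrite divr_gt0.
rewrite sub0r normrN gtr0_norm ?divr_gt0 // ltr_pdivrMr // ltr_pMr // ltr1n.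
by [].
Qed.

(** If [g] has no zero on the sphere, some coordinate of [g x] has absolute value at least a fixed
    [delta]. That coordinate and its sign label [x], and on a fine subdivision the labelling
    contradicts Ky Fan's lemma. *)
Theorem borsuk_ulam m d (g : 'rV[R]_m -> 'rV[R]_d) : (d < m)%N ->
  continuous g -> (forall x, cross_sphere x -> g (- x) = - g x) ->
  exists2 x, cross_sphere x & g x = 0.
Proof.
move=> dm cg oddg; apply: contrapT => nog.
have e0O : cross_sphere (@cross_vertex R m 0).
  have m0 : (0 < m)%N by exact: leq_ltn_trans dm.
  rewrite /cross_sphere /= (bigD1 (Ordinal m0)) //= mxE /= normr1 big1 ?addr0 //.
  by move=> i i0; rewrite mxE (_ : _ == _ = false) ?normr0 //; exact: negbTE.
have [delta d0 gd] : exists2 delta : R, 0 < delta &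
    forall x, cross_sphere x -> delta <= `|g x|.
  have [|||c] := @EVT_min_rV R m (fun x => `|g x|) (@cross_sphere R m).
  - by exists (cross_vertex R m 0).
  - exact: cross_sphere_compact.
  - apply: continuous_subspaceT => x; apply: continuous_comp; first exact: cg.
    exact: norm_continuous.
  rewrite inE => Oc cmin; exists `|g c|; last first.
    by move=> x Ox; apply: cmin; rewrite inE.
  by rewrite normr_gt0; apply/eqP => gc0; apply: nog; exists c.
have [eps eps0 unif] :=
  compact_uniform_continuity (@cross_sphere_compact m) cg d0.
have [N NP] : exists N, forall j, (j <= d)%N ->
    (j%:R / j.+1%:R) ^+ N * 2 < eps :> R.
  pose k : R := d%:R / d.+1%:R.
  have k0 : 0 <= k by rewrite divr_ge0.
  have k1 : `|k| < 1 by rewrite ger0_norm // ltr_pdivrMr // mul1r ltr_nat.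
  have /cvgrPdist_lt/(_ (eps / 2)) := cvg_expr k1.
  rewrite divr_gt0 // => /(_ isT)[N _ /(_ N (leqnn N)) /=].
  rewrite sub0r normrN ger0_norm ?exprn_ge0 // ltr_pdivlMr // => kN.
  exists N => j jd; apply: le_lt_trans kN.
  rewrite ler_wpM2r // lerXn2r ?nnegrE ?divr_ge0 //.
  rewrite ler_pdivrMr // mulrAC ler_pdivlMr // -!natrM ler_nat.
  by rewrite !mulnS [(d * j)%N]mulnC leq_add2r.
(* The choice depends on absolute values only, so antipodal points choose the same coordinate. The
   default label is never reached on the sphere. *)
pose big x := [pick i | delta <= `|g x 0 i|].
pose ell x := if big x is Some i then (i.*2 + (0 < g x 0 i)%R)%N else 0%N.
have ellP x : cross_sphere x -> exists i : 'I_d,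
    [/\ delta <= `|g x 0 i|, big x = Some i &
        ell x = (i.*2 + (0 < g x 0 i)%R)%N].
  move=> Ox; rewrite /ell /big; case: pickP => [i gi|none]; first by exists i.
  have := gd _ Ox; rewrite leNgt => /negP[].
  by apply: mx_norm_lt => // i; rewrite ltNge none.
have ell_half x (i : 'I_d) :
    ell x = (i.*2 + (0 < g x 0 i)%R)%N -> (ell x)./2 = i.
  by move=> ->; rewrite addnC half_bit_double.
pose X := octsd -%R (@cross_vertex R m) (@bary R 'rV[R]_m) N.
have Xsphere j s v : (j <= d)%N -> s \in X j -> v \in s -> cross_sphere v.
  move=> jd /octsd_cross[|sg [s1 sP] vs]; first exact: leq_ltn_trans dm.
  exact: cross_face_sphere (sP _ vs).
apply: (@fan_contradiction _ -%R X (@cross_vertex R m 0) _ _ _ d ell).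
- exact: octsd0 (@bary1 _ _) N.
- exact: size_octsd.
- move=> j; apply: bdc_octsd; [exact: opprK|exact: bary_opp].
- move=> j s v jd sX vs; have Ov := Xsphere _ _ _ jd sX vs.
  have [i [gi bi li]] := ellP v Ov.
  have [i' [gi' bi' li']] := ellP _ (cross_sphereN Ov).
  have ii' : i' = i.
    apply: Some_inj; rewrite -bi -bi' /big; apply: eq_pick => k.
    by rewrite oddg // mxE normrN.
  rewrite li' ii' /flip (ell_half _ _ li) li oddg // mxE oppr_gt0.
  congr (_ + nat_of_bool _)%N; rewrite oddD odd_double /= oddb.
  have : g v 0 i != 0 by rewrite -normr_gt0 (lt_le_trans d0).
  by case: ltgtP.
- move=> j s v jd sX vs; have [i [_ _ ->]] := ellP v (Xsphere _ _ _ jd sX vs).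
  rewrite (@leq_trans i.+1.*2) ?leq_double // doubleS.
  by case: (0 < _); rewrite ?addn1 ?addn0.
- move=> j s jd sX _ _ /mapP[x xs ->] /mapP[y ys ->].
  have Ox := Xsphere _ _ _ jd sX xs; have Oy := Xsphere _ _ _ jd sX ys.
  have [i [gi bi li]] := ellP x Ox; have [i' [gi' bi' li']] := ellP y Oy.
  rewrite (ell_half _ _ li) (ell_half _ _ li') => /val_inj ii'.
  rewrite li li' -ii'; congr (_ + nat_of_bool _)%N.
  (* Opposite signs would put the [i]-th coordinates at least [2 * delta] apart, whereas the mesh
     keeps them closer than [delta]. *)
  have xy : `|g x - g y| < delta.
    apply: unif => //; apply: le_lt_trans (NP j jd).
    by apply: octsd_diameter sX _ _ xs ys; exact: leq_ltn_trans dm.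
  have := le_lt_trans (ler_mx_norm_coord _ i) xy; rewrite !mxE.
  move: gi' gi; rewrite -ii'; move: (g x 0 i) (g y 0 i) => a b.
  rewrite ltr_norml => gb ga /andP[h1 h2].
  case: (ltrP 0 a) ga => a0; rewrite ?(gtr0_norm a0) ?(ler0_norm a0) => ga;
    case: (ltrP 0 b) gb => b0; rewrite ?(gtr0_norm b0) ?(ler0_norm b0) //; lra.
Qed.

End BorsukUlam.

(** * Odd extensions and odd descent *)

(** Tietze's theorem extends each coordinate, and the odd part of the extension still agrees with
    [phi] on [A] because [A] is symmetric and [phi] is odd there. *)
Lemma odd_extension (R : realType) m d (A : set 'rV[R]_m)
    (phi : 'rV[R]_m -> 'rV[R]_d) :
  closed A -> {within A, continuous phi} -> (forall x, A x -> A (- x)) ->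
  (forall x, A x -> phi (- x) = - phi x) -> (forall x, A x -> `|phi x| <= 1) ->
  exists g : 'rV[R]_m -> 'rV[R]_d,
    [/\ continuous g, forall x, g (- x) = - g x & forall x, A x -> g x = phi x].
Proof.
move=> clA cphi symA oddphi phi1.
have /choice[h hP] : forall i : 'I_d, exists h : 'rV[R]_m -> R,
    continuous h /\ forall x, A x -> h x = phi x 0 i.
  move=> i; have := @continuous_bounded_extension _ R
    (@pseudometric_normal R 'rV[R]_m) A clA (fun x => phi x 0 i) 1 ltr01.
  case.
  - apply: (@within_continuous_comp _ _ _ A phi (fun y => y 0 i)) => //.
    by move=> y _; exact: coord_continuousr.
  - by move=> x Ax; rewrite (le_trans (ler_mx_norm_coord _ _)) // phi1.
  move=> h [hE ch _]; exists h; split=> // x Ax.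
  by rewrite -hE //; exact/mem_set.
exists (fun x => \row_i ((h i x - h i (- x)) / 2)); split.
- apply: continuous_rV => i.
  rewrite (_ : (fun _ => _) = fun x => (h i x - h i (- x)) / 2); last first.
    by apply/funext => x; rewrite mxE.
  have [ch _] := hP i; move=> x.
  have cN : h i (- y) @[y --> x] --> h i (- x).
    by apply: continuous_comp; [exact: opp_continuous|exact: ch].
  exact: (cvgM (cvgB (ch x) cN) (cvg_cst _)).
- by move=> x; apply/rowP => i; rewrite !mxE opprK -mulNr opprB.
- move=> x Ax; apply/rowP => i; rewrite mxE; have [_ hA] := hP i.
  rewrite !hA //; last exact: symA.
  by rewrite oddphi // mxE opprK; lra.
Qed.

Lemma has_odd_map_genus (R : realType) n (S : set 'rV[R]_n) :
  has_odd_map S (genus S).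
Proof.
have [S0|/genusP[] //] := pselect (S `\ 0 = set0).
rewrite /has_odd_map S0; exists (fun=> 0); split => //.
exact: continuous_subspace0.
Qed.

Lemma esphere_norm (R : realType) k (y : 'rV[R]_k) : esphere y -> `|y| <= 1.
Proof.
move=> y1; apply: mx_norm_le => // i.
have : `|y 0 i| ^+ 2 <= 1 ^+ 2.
  rewrite real_normK ?num_real // expr1n -[leRHS]y1 (bigD1 i) //= lerDl.
  by apply: sumr_ge0 => j _; exact: sqr_ge0.
by rewrite ler_pXn2r ?nnegrE.
Qed.

Lemma esphere_neq0 (R : realType) k (y : 'rV[R]_k) : esphere y -> y <> 0.
Proof.
rewrite /esphere /= => + y0; rewrite y0 big1 => [/esym/eqP|i _].
  by rewrite oner_eq0.
by rewrite mxE expr0n.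
Qed.

(** * Patching local descent directions into an odd map *)

Section OddDescent.
Variables (R : realType) (V : normedModType R) (F : V -> R).

(** A triple packs the centre of a ball, a direction and the radius. The base point ranges over the
    whole ball, so that steps in several directions can be composed. *)
Definition descends (c : V * V * R) : Prop :=
  forall y t, 0 < t -> `|c.1.1 - y| < c.2 ->
  `|c.1.1 - (y + t *: c.1.2)| < c.2 ->
  F (y + t *: c.1.2) < F y.

(* Twice the positive part of [c.2 / 2 - `|c.1.1 - x|]. *)
Definition bump (c : V * V * R) (x : V) : R :=
  (c.2 / 2 - `|c.1.1 - x|) + `|c.2 / 2 - `|c.1.1 - x| |.

Lemma bump_ge0 c x : 0 <= bump c x.
Proof.
rewrite /bump; move: (_ - `|_|) => a.
by have := ler_norm (- a); rewrite normrN; lra.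
Qed.

Lemma bump_gt0 c x : (0 < bump c x) = (`|c.1.1 - x| < c.2 / 2).
Proof.
rewrite /bump -[RHS]subr_gt0; move: (_ - _) => a.
case: (ltrP 0 a) => a0; first by rewrite gtr0_norm // addr_gt0.
by rewrite ler0_norm // subrr ltxx.
Qed.

Lemma bump_le c x : 0 < c.2 -> bump c x <= c.2.
Proof.
move=> c0; have := normr_ge0 (c.1.1 - x); rewrite /bump; move: `|_ - x| => a a0.
by case: (ger0P (c.2 / 2 - a)) => h; lra.
Qed.

Lemma bump_continuous c : continuous (bump c).
Proof.
have ca : continuous (fun x => c.2 / 2 - `|c.1.1 - x|).
  move=> x; apply: cvgB; first exact: cvg_cst.
  apply: cvg_norm; apply: cvgB; [exact: cvg_cst|exact: cvg_id].
by move=> x; apply: cvgD; [exact: ca|apply: cvg_norm; exact: ca].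
Qed.

(** The steps are made one after another. The total displacement keeps every intermediate point
    within [mu] of [x]; if [bump c x] is positive, [x] lies in the half ball of [c], so these points
    stay in its full ball and the step descends. The other steps are trivial. *)
Lemma descend_along (l : seq (V * V * R)) (s mu : R) (x y : V) : 0 < s ->
  (forall c, c \in l -> descends c /\ mu <= c.2 / 2) ->
  `|x - y| + s * (\sum_(c <- l) bump c x * `|c.1.2|) < mu ->
  let z := y + s *: \sum_(c <- l) bump c x *: c.1.2 in
  F z <= F y /\ (has (fun c => 0 < bump c x) l -> F z < F y).
Proof.
move=> s0; elim: l y => [|c l ih] y lP ylt /=.
  by rewrite big_nil scaler0 addr0.
rewrite !big_cons in ylt *; rewrite scalerDr addrA scalerA.
have [dc muc] := lP c (mem_head _ _).
have {}lP c' : c' \in l -> descends c' /\ mu <= c'.2 / 2.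
  by move=> c'l; apply: lP; rewrite inE c'l orbT.
have sum0 : 0 <= \sum_(c <- l) bump c x * `|c.1.2|.
  by apply: sumr_ge0 => i _; rewrite mulr_ge0 // bump_ge0.
set y' := y + (s * bump c x) *: c.1.2.
have xy' : `|x - y'| <= `|x - y| + s * (bump c x * `|c.1.2|).
  rewrite /y' opprD addrA (le_trans (ler_normB _ _)) // lerD2l normrZ.
  by rewrite ger0_norm ?mulr_ge0 ?bump_ge0 ?(ltW s0) // mulrA.
have := ih y' lP; case.
  by apply: le_lt_trans ylt; rewrite mulrDr addrA lerD2r.
rewrite /= => le lt; have [b0|] := ltrP 0 (bump c x).
  suff yy' : F y' < F y.
    by split=> [|_]; [exact: ltW (le_lt_trans le yy')|exact: le_lt_trans le yy'].
  have c0 : `|c.1.1 - x| < c.2 / 2 by rewrite -bump_gt0.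
  have sb0 : 0 <= s * (bump c x * `|c.1.2|).
    by rewrite mulr_ge0 ?(ltW s0) // mulr_ge0 // bump_ge0.
  have sl0 : 0 <= s * \sum_(c <- l) bump c x * `|c.1.2|.
    by rewrite mulr_ge0 // ltW.
  have ball w : `|x - w| < mu -> `|c.1.1 - w| < c.2.
    move=> xw; rewrite -(subrKA x) (le_lt_trans (ler_normD _ _)) //.
    by rewrite [c.2]splitr ltrD // (lt_le_trans xw).
  rewrite mulrDr in ylt.
  apply: dc; [exact: mulr_gt0| |]; apply: ball; last apply: (le_lt_trans xy');
    lra.
move=> b0; have bE : bump c x = 0.
  by apply/eqP; rewrite eq_le b0 bump_ge0.
by move: le lt; rewrite /y' bE mulr0 scale0r addr0.
Qed.

Lemma exists_lower_bound (T : eqType) (l : seq T) (r : T -> R) :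
  (forall c, c \in l -> 0 < r c) ->
  exists2 mu, 0 < mu & forall c, c \in l -> mu <= r c.
Proof.
elim: l => [|a l ih] lP; first by exists 1.
have [|mu mu0 muP] := ih.
  by move=> c cl; apply: lP; rewrite inE cl orbT.
exists (Num.min mu (r a)); first by rewrite lt_min mu0 lP // mem_head.
move=> c; rewrite inE => /predU1P[->|/muP]; first by rewrite ge_min lexx orbT.
by rewrite ge_min => ->.
Qed.

Lemma odd_descent (D : set V) : compact D -> (forall x, F (- x) = F x) ->
  (forall x, D x -> exists2 c, c.1.1 = x & 0 < c.2 /\ descends c) ->
  exists eta : V -> V,
    [/\ continuous eta, forall x, eta (- x) = - eta x &
        forall x, D x -> F (eta x) < F x].
Proof.
move=> cD evenF DP.
have [l lP lD] : exists2 l : seq (V * V * R),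
    forall c, c \in l -> 0 < c.2 /\ descends c &
    forall x, D x -> exists2 c, c \in l & 0 < bump c x.
  have /choice[w wP] : forall x : V, exists c, D x ->
      c.1.1 = x /\ 0 < c.2 /\ descends c.
    move=> x; have [/DP[c cx cP]|nDx] := pselect (D x); first by exists c.
    by exists (0, 0, 0).
  move: cD; rewrite compact_cover => cD.
  have [||A AD cover] := cD V D (fun x => [set y | D x /\ 0 < bump (w x) y]).
  - move=> x Dx; rewrite (_ : [set _ | _] = bump (w x) @^-1` [set t | 0 < t]).
      by apply: open_comp; [move=> y _; exact: bump_continuous|exact: open_gt].
    by apply/seteqP; split=> y /=; [case|].
  - move=> x Dx; exists x => //=; split=> //; have [wx [w0 _]] := wP x Dx.
    by rewrite bump_gt0 wx subrr normr0 divr_gt0.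
  exists (map w (finmap.enum_fset A)).
    move=> c /mapP[x /AD xD ->].
    by move: xD; rewrite inE => /wP[].
  move=> x /cover[y /= yA [Dy b0]]; by exists (w y) => //; apply: map_f.
(* Since [F] is even, the reflected triples descend too; adding them makes the displacement odd. *)
pose neg (c : V * V * R) := (- c.1.1, - c.1.2, c.2).
pose l2 := l ++ map neg l.
have bump_neg c x : bump (neg c) x = bump c (- x).
  by rewrite /bump /= -opprD normrN opprK.
have l2P c : c \in l2 -> 0 < c.2 /\ descends c.
  rewrite mem_cat => /orP[/lP //|/mapP[{}c /lP[c0 dc] ->]]; split=> // y t t0 /=.
  rewrite scalerN => h1 h2; rewrite -evenF -[ltRHS]evenF opprB addrC.
  apply: dc => //; rewrite ?opprK.
    by move: h1; rewrite -opprD normrN.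
  rewrite (_ : _ - _ = - (- c.1.1 - (y - t *: c.1.2))) ?normrN //.
  by rewrite [RHS]opprD !opprK opprD opprK.
have [mu mu0 muP] := @exists_lower_bound _ l2 (fun c => c.2 / 2)
  (fun c cl => divr_gt0 (l2P c cl).1 (ltr0Sn _ 1)).
pose M := \sum_(c <- l2) c.2 * `|c.1.2|.
have M0 : 0 <= M.
  rewrite /M big_seq; apply: sumr_ge0 => c /l2P[c0 _].
  by rewrite mulr_ge0 // ltW.
(* As [bump c x <= c.2], [M] bounds the unscaled displacement; this choice gives [s * M < mu], even
   when [M] is zero. *)
pose s := mu / (1 + M).
have s0 : 0 < s by rewrite divr_gt0 // ltr_wpDr.
pose shift x := \sum_(c <- l) (bump c x - bump c (- x)) *: c.1.2.
have shiftE x : shift x = \sum_(c <- l2) bump c x *: c.1.2.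
  rewrite big_cat big_map /= -big_split /=; apply: eq_bigr => c _.
  by rewrite bump_neg scalerN -scalerBl.
exists (fun x => x + s *: shift x); split.
- move=> x; apply: cvgD; first exact: cvg_id.
  apply: cvgZr; rewrite /shift.
  elim: l {lP lD l2 l2P muP M M0 s s0 shift shiftE} => [|c l ih].
    rewrite (_ : (fun _ => _) = fun=> 0); last first.
      by apply/funext => y; rewrite big_nil.
    by rewrite big_nil; exact: cvg_cst.
  rewrite big_cons (_ : (fun _ => _) = fun y =>
     (bump c y - bump c (- y)) *: c.1.2 +
     \sum_(c <- l) (bump c y - bump c (- y)) *: c.1.2); last first.
    by apply/funext => y; rewrite big_cons.
  apply: cvgD => //; apply: cvgZl; apply: cvgB; first exact: bump_continuous.
  by apply: continuous_comp; [exact: opp_continuous|exact: bump_continuous].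
- move=> x; rewrite opprD -scalerN; congr (_ + _ *: _); rewrite /shift -sumrN.
  by apply: eq_bigr => c _; rewrite opprK -scaleNr opprB.
- move=> x Dx; rewrite shiftE.
  have [||_] := @descend_along l2 s mu x x s0.
  - by move=> c cl; split; [have [] := l2P c cl|exact: muP].
  - rewrite subrr normr0 add0r (@le_lt_trans _ _ (s * M)) //.
      rewrite ler_pM2l // /M !big_seq; apply: ler_sum => c /l2P[c0 _].
      by rewrite ler_wpM2r // bump_le.
    rewrite /s mulrAC ltr_pdivrMr ?ltr_wpDr // ltr_pM2l //; lra.
  apply; have [c cl c0] := lD x Dx; apply/hasP; exists c => //.
  by rewrite mem_cat cl.
Qed.

End OddDescent.

(** * Critical points of sums of powers of linear forms *)

Lemma near_dist_lt (R : realType) (t e : R) : 0 < e ->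
  \forall s \near t, `|t - s| < e.
Proof.
move=> e0; have /cvgrPdist_lt/(_ e e0) : (s @[s --> t] --> t) by exact: cvg_id.
by [].
Qed.

Section PowerSubdifferential.
Variables (R : realType) (p : R).
Hypothesis p1 : 1 <= p.
Implicit Types s t z : R.

(* The subdifferential of [fun t => `|t| `^ p / p]. *)
Definition subdiff t : set R := if p == 1 then Sgn t else [set dualpow p t].

Let p_gt0 : 0 < p. Proof. exact: lt_le_trans p1. Qed.

Lemma powR_continuous_pos (q t : R) : 0 < t -> {for t, continuous (@powR R ^~ q)}.
Proof.
move=> t0; apply: differentiable_continuous; apply/derivable1_diffP.
by apply: derivable_powR; rewrite in_itv /= t0.
Qed.

Lemma normr_powR_continuous (q : R) : 0 < q -> continuous (fun t : R => `|t| `^ q).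
Proof.
move=> q0 t; have [->|t0] := eqVneq t 0; last first.
  apply: (@continuous_comp _ _ _ (fun t : R => `|t|) (@powR R ^~ q)).
    exact: norm_continuous.
  by apply: powR_continuous_pos; rewrite normr_gt0.
apply/cvgrPdist_lt => e e0.
apply: filterS (near_dist_lt 0 (powR_gt0 q^-1 e0)) => s; rewrite sub0r normrN => se.
rewrite normr0 powR0 ?gt_eqF // sub0r normrN ger0_norm ?powR_ge0 //.
have -> : e = (e `^ q^-1) `^ q by rewrite -powRrM mulVf ?gt_eqF // powRr1 // ltW.
by apply: gt0_ltr_powR; rewrite // nnegrE // powR_ge0.
Qed.

Lemma normr_dualpow t : 1 < p -> `|dualpow p t| = `|t| `^ (p - 1).
Proof.
move=> lt1p; rewrite /dualpow normrM ger0_norm ?powR_ge0 //.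
have [->|t0] := eqVneq t 0.
  by rewrite normr0 mulr0 powR0 // subr_eq0 gt_eqF.
rewrite -{2}[`|t|]powRr1 // -powRD; last by rewrite normr_eq0 t0 implybT.
by congr (_ `^ _); lra.
Qed.

Lemma dualpow_continuous : 1 < p -> continuous (dualpow p).
Proof.
move=> lt1p t; have [->|t0] := eqVneq t 0; last first.
  apply: cvgM; last exact: cvg_id.
  apply: (@continuous_comp _ _ _ (fun t : R => `|t|) (@powR R ^~ (p - 2))).
    exact: norm_continuous.
  by apply: powR_continuous_pos; rewrite normr_gt0.
apply/cvgrPdist_lt => e e0.
have p10 : 0 < p - 1 by rewrite subr_gt0.
have /cvgrPdist_lt/(_ e e0) := @normr_powR_continuous (p - 1) p10 0.
apply: filterS => s; rewrite normr0 powR0 ?gt_eqF //.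
by rewrite [dualpow p 0]mulr0 !sub0r !normrN normr_dualpow // ger0_norm // powR_ge0.
Qed.

Lemma subdiff_mul t z : subdiff t z -> z * t = `|t| `^ p.
Proof.
rewrite /subdiff; case: eqP => [->|_].
  rewrite /Sgn powRr1 //; case: eqP => [-> _|_ ->]; first by rewrite mulr0 normr0.
  by rewrite normrEsg.
move=> ->; rewrite /dualpow -mulrA -expr2 -[t ^+ 2]real_normK ?num_real //.
have [->|t0] := eqVneq t 0; first by rewrite normr0 expr0n mulr0 powR0 ?gt_eqF.
rewrite -powR_mulrn // -powRD ?normr_eq0 ?t0 ?implybT //.
by congr (_ `^ _); lra.
Qed.

Lemma normr_subdiff t z : subdiff t z -> `|z| <= `|t| `^ (p - 1).
Proof.
rewrite /subdiff; case: eqP => [->|/eqP p1'].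
  rewrite subrr powRr0 /Sgn; case: eqP => [_|t0 ->].
    by rewrite /= in_itv /= ler_norml.
  by rewrite normr_sg; case: (_ != _).
by move=> ->; rewrite normr_dualpow // lt_neqAle eq_sym p1'.
Qed.

(** Young's inequality with exponents [p] and [p / (p - 1)], multiplied by [p]; at [p = 1] both
    sides are equal. *)
Lemma young_powR s t : p * (`|t| `^ (p - 1) * `|s|) <=
  `|s| `^ p + (p - 1) * `|t| `^ p.
Proof.
have [->|p1'] := eqVneq p 1.
  by rewrite subrr powRr0 !powRr1 // !mul1r mul0r addr0.
have lt1p : 1 < p by rewrite lt_neqAle eq_sym p1'.
have p10 : 0 < p - 1 by rewrite subr_gt0.
have := @conjugate_powR R `|s| (`|t| `^ (p - 1)) p (p / (p - 1))
  (normr_ge0 _) (powR_ge0 _ _) p_gt0 (divr_gt0 p_gt0 p10).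
rewrite -powRrM (_ : (p - 1) * (p / (p - 1)) = p); last first.
  by field; rewrite gt_eqF.
rewrite invf_div => /(_ _) H.
have {}H := H ltac:(by field; rewrite gt_eqF).
rewrite -(ler_pM2l p_gt0) in H; rewrite [X in p * X]mulrC (le_trans H) //.
rewrite mulrDr mulrCA mulfV ?gt_eqF // mulr1 lerD2l mulrCA.
rewrite (_ : p * ((p - 1) / p) = p - 1); first by rewrite mulrC.
by field; rewrite gt_eqF.
Qed.

Lemma subdiff_ineq s t z : subdiff t z ->
  `|t| `^ p + p * (z * (s - t)) <= `|s| `^ p.
Proof.
move=> zt; rewrite mulrBr (subdiff_mul zt).
have := young_powR s t.
have : p * (z * s) <= p * (`|t| `^ (p - 1) * `|s|).
  rewrite ler_pM2l // (le_trans (ler_norm _)) // normrM ler_wpM2r //.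
  exact: normr_subdiff.
rewrite mulrBr mulrBl mul1r; lra.
Qed.

Lemma subdiffN t z : subdiff t z -> subdiff (- t) (- z).
Proof.
rewrite /subdiff; case: eqP => [_|_ ->]; last first.
  by rewrite /dualpow /= normrN mulrN.
rewrite /Sgn oppr_eq0; case: eqP => [_|_ ->]; last by rewrite /= sgrN.
by rewrite /= !in_itv /= => /andP[a b]; apply/andP; split; lra.
Qed.

Lemma subdiff_nonempty t : exists z, subdiff t z.
Proof.
rewrite /subdiff; case: ifP => _; last by exists (dualpow p t).
rewrite /Sgn; case: ifP => _; last by exists (Num.sg t).
by exists 0; rewrite /= in_itv /=; apply/andP; split; lra.
Qed.

Lemma subdiff_compact t : compact (subdiff t).
Proof.
rewrite /subdiff /Sgn; case: ifP => _; last exact: compact_set1.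
by case: ifP => _; [exact: segment_compact|exact: compact_set1].
Qed.

Lemma subdiff_convex t z z' (a : R) : 0 <= a <= 1 -> subdiff t z ->
  subdiff t z' -> subdiff t (z + a * (z' - z)).
Proof.
move=> /andP[a0 a1]; rewrite /subdiff /Sgn; case: ifP => _; last first.
  by move=> -> -> /=; rewrite subrr mulr0 addr0.
case: ifP => _; last by move=> -> -> /=; rewrite subrr mulr0 addr0.
rewrite /= !in_itv /= => /andP[u1 u2] /andP[v1 v2]; apply/andP; split; nra.
Qed.

(** For [p > 1] this is continuity of [dualpow]. For [p = 1], [Sgn] is locally constant away from 0,
    and at 0 it is the whole of [[-1, 1]]. *)
Lemma subdiff_usc t (e : R) : 0 < e ->
  \forall s \near t, forall z, subdiff s z ->
    exists2 z', subdiff t z' & `|z - z'| < e.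
Proof.
move=> e0; rewrite /subdiff; case: eqP => [_|/eqP p1']; last first.
  have lt1p : 1 < p by rewrite lt_neqAle eq_sym p1'.
  have /cvgrPdist_lt/(_ e e0) := @dualpow_continuous lt1p t.
  by apply: filterS => s h z ->; exists (dualpow p t); rewrite // distrC.
have [t0|t0] := eqVneq t 0.
  apply: (@filterE _ (nbhs t)) => s z sz; exists z; last by rewrite subrr normr0.
  rewrite t0 /Sgn eqxx; move: sz; rewrite /Sgn; case: eqP => // _ ->.
  rewrite /= in_itv /=; case: sgrP => _; apply/andP; split; lra.
have nt0 : 0 < `|t| by rewrite normr_gt0.
apply: filterS (near_dist_lt t nt0) => s st z sz; exists z; last by rewrite subrr normr0.
suff -> : Sgn t = Sgn s by [].
rewrite /Sgn; have [ht|ht|te] := ltrgtP t 0; last by rewrite te eqxx in t0.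
  move: st; rewrite (ltr0_norm ht) ltr_norml => /andP[lo hi].
  have s0 : s < 0 by lra.
  by rewrite lt_eqF // !ltr0_sg.
move: st; rewrite (gtr0_norm ht) ltr_norml => /andP[lo hi].
have s0 : 0 < s by lra.
by rewrite gt_eqF // !gtr0_sg.
Qed.

End PowerSubdifferential.

(** * Weighted energies, their critical points and descent directions *)

Section Critical.
Variables (R : realType) (n : nat) (I : finType) (a : I -> 'I_n -> R).
Variables (kappa : I -> R) (p : R).
Hypothesis p1 : 1 <= p.
Implicit Types (f g y v : 'rV[R]_n) (c : I -> R).

Definition lform (x : I) g : R := \sum_i a x i * g 0 i.

Definition energy g : R := \sum_x kappa x * `|lform x g| `^ p.

(** The weights may be negative, so the energy is a difference of convex functions; the condition is
    that 0 lies in the weighted sum of the subdifferentials. *)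
Definition critical g : Prop :=
  exists2 c : I -> R, forall x, subdiff p (lform x g) (c x) &
    forall i, \sum_x kappa x * c x * a x i = 0.

Lemma lform_continuous x : continuous (lform x).
Proof.
apply: continuous_sumr => i y.
exact: (cvgM (cvg_cst _) (@coord_continuousr R n i y)).
Qed.

Lemma lformD x y v : lform x (y + v) = lform x y + lform x v.
Proof.
by rewrite /lform -big_split; apply: eq_bigr => i _; rewrite mxE mulrDr.
Qed.

Lemma lformZ x (t : R) v : lform x (t *: v) = t * lform x v.
Proof.
by rewrite /lform mulr_sumr; apply: eq_bigr => i _; rewrite mxE mulrCA.
Qed.

Lemma lformN x v : lform x (- v) = - lform x v.
Proof. by rewrite -scaleN1r lformZ mulN1r. Qed.

Lemma energyN g : energy (- g) = energy g.
Proof. by apply: eq_bigr => x _; rewrite lformN normrN. Qed.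

Lemma energy0 : energy 0 = 0.
Proof.
apply: big1 => x _; rewrite (_ : lform x 0 = 0).
  by rewrite normr0 powR0 ?mulr0 // gt_eqF // (lt_le_trans _ p1).
by apply: big1 => i _; rewrite mxE mulr0.
Qed.

Lemma criticalN g : critical g -> critical (- g).
Proof.
move=> [c cg c0]; exists (fun x => - c x) => [x|i].
  by rewrite lformN; exact: subdiffN.
transitivity (- \sum_x kappa x * c x * a x i); last by rewrite c0 oppr0.
rewrite -sumrN; apply: eq_bigr => x _.
by rewrite mulrN mulNr.
Qed.

Lemma sum_lform c v : \sum_x kappa x * c x * lform x v =
  \sum_i (\sum_x kappa x * c x * a x i) * v 0 i.
Proof.
under eq_bigr do rewrite /lform mulr_sumr.
rewrite exchange_big; apply: eq_bigr => i _ /=; rewrite mulr_suml.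
by apply: eq_bigr => x _; rewrite mulrA.
Qed.

(* The direction is opposite to the residual of least Euclidean norm. *)
Lemma separating_direction g : ~ critical g ->
  exists v (e : R), 0 < e /\
    forall c, (forall x, subdiff p (lform x g) (c x)) ->
      \sum_x kappa x * c x * lform x v <= - e.
Proof.
move=> ncr.
pose B : set 'rV[R]_#|I| :=
  [set u | forall k, subdiff p (lform (enum_val k) g) (u 0 k)].
have cB : compact B.
  apply: (@rV_compact _ _ (fun k => subdiff p (lform (enum_val k) g))) => k.
  exact: subdiff_compact.
pose res (u : 'rV[R]_#|I|) (i : 'I_n) : R :=
  \sum_x kappa x * u 0 (enum_rank x) * a x i.
have cres i : continuous (res ^~ i).
  apply: continuous_sumr => x u.
  exact: (cvgM (cvgM (cvg_cst _) (@coord_continuousr R _ _ u)) (cvg_cst _)).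
have [|||u] := @EVT_min_rV R _ (fun u => \sum_i res u i ^+ 2) B.
- have /choice[z zP] : forall k : 'I_#|I|, exists z,
      subdiff p (lform (enum_val k) g) z.
    by move=> k; exact: subdiff_nonempty.
  by exists (\row_k z k) => k; rewrite mxE.
- exact: cB.
- apply: continuous_subspaceT; apply: continuous_sumr => i u.
  exact: (cvgM (cres i u) (cres i u)).
rewrite inE => Bu umin.
exists (- \row_i res u i), (\sum_i res u i ^+ 2); split.
  rewrite lt_neqAle sumr_ge0 ?andbT => [|i _]; last exact: sqr_ge0.
  apply/eqP => /esym/eqP; rewrite psumr_eq0 => [/allP u0|i _]; last exact: sqr_ge0.
  apply: ncr; exists (fun x => u 0 (enum_rank x)) => [x|i].
    by have := Bu (enum_rank x); rewrite enum_rankK.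
  by have := u0 i (mem_index_enum _); rewrite sqrf_eq0 => /eqP.
move=> c cP; rewrite sum_lform.
pose w : 'rV[R]_#|I| := \row_k c (enum_val k).
have Bw : B w by move=> k; rewrite mxE; exact: cP.
have resw i : \sum_x kappa x * c x * a x i = res w i.
  by apply: eq_bigr => x _; rewrite mxE enum_rankK.
under eq_bigr do rewrite resw !mxE mulrN; rewrite sumrN lerN2.
pose d i := res w i - res u i.
suff : 0 <= \sum_i d i * res u i.
  rewrite -subr_ge0 -sumrB; congr (0 <= _); apply: eq_bigr => i _.
  by rewrite /d mulrBl expr2.
pose A := \sum_i d i * res u i; pose Q := \sum_i d i ^+ 2.
have Q0 : 0 <= Q by apply: sumr_ge0 => i _; exact: sqr_ge0.
(* Minimality of the residual at [u], tested on the segment from [u] to [w] and divided by [t]. *)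
have key (t : R) : 0 < t -> t <= 1 -> 0 <= 2 * A + t * Q.
  move=> t0 t1.
  have Bt : B (u + t *: (w - u)).
    move=> k; rewrite !mxE; apply: subdiff_convex; [by rewrite (ltW t0)| |].
      exact: Bu.
    by have := Bw k; rewrite mxE.
  have rest i : res (u + t *: (w - u)) i = res u i + t * d i.
    rewrite /res /d /res -sumrB mulr_sumr -big_split; apply: eq_bigr => x _.
    by rewrite !mxE /=; ring.
  have := umin _ (mem_set Bt); rewrite -subr_ge0 -sumrB.
  under eq_bigr do rewrite rest.
  have -> : \sum_i ((res u i + t * d i) ^+ 2 - res u i ^+ 2) = t * (2 * A + t * Q).
    rewrite /A /Q !mulr_sumr -big_split mulr_sumr; apply: eq_bigr => i _ /=; ring.
  by rewrite pmulr_rge0.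
rewrite leNgt; apply/negP => A0; rewrite -/A in A0.
(* For this [t], [t * Q <= - A], so [2 * A + t * Q <= A < 0] contradicts [key]. *)
pose t := Num.min 1 (- A / (Q + 1)).
have Q1 : 0 < Q + 1 by lra.
have t0 : 0 < t by rewrite lt_min ltr01 divr_gt0 // oppr_gt0.
have tQ : t * (Q + 1) <= - A by rewrite -ler_pdivlMr // ge_min lexx orbT.
have := key t t0; rewrite ge_min lexx /= => /(_ isT).
nra.
Qed.

(** By semicontinuity each [c x] is [e']-close to a subgradient at [g], which costs at most
    [e' * S < e]. Each form may use its own point [y], a freedom needed to treat weights of both
    signs. *)
Lemma noncritical_nbhs g : ~ critical g -> exists v (d : R), 0 < d /\
  forall c, (forall x, exists2 y, `|g - y| < d & subdiff p (lform x y) (c x)) ->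
    \sum_x kappa x * c x * lform x v < 0.
Proof.
move=> /separating_direction[v [e [e0 ve]]].
pose S := \sum_x `|kappa x * lform x v|.
have S0 : 0 <= S by apply: sumr_ge0.
pose e' := e / (S + 1).
have e'0 : 0 < e' by rewrite divr_gt0 // ltr_wpDl.
have : nbhs g [set y | forall x z, subdiff p (lform x y) z ->
    exists2 z', subdiff p (lform x g) z' & `|z - z'| < e'].
  apply: (@filter_forall _ _ (fun x y => forall z, subdiff p (lform x y) z ->
    exists2 z', subdiff p (lform x g) z' & `|z - z'| < e') (nbhs g)) => x.
  exact: (lform_continuous (subdiff_usc p1 _ e'0)).
move=> /nbhs_ballP[d /= d0 dP]; exists v, d; split=> // c cP.
have /choice[c' c'P] : forall x, exists z',
    subdiff p (lform x g) z' /\ `|c x - z'| < e'.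
  move=> x; have [y gy cy] := cP x.
  have [|z' ? ?] := dP y _ x (c x) cy; first by rewrite -ball_normE.
  by exists z'.
have := ve c' (fun x => (c'P x).1).
have : \sum_x kappa x * c x * lform x v - \sum_x kappa x * c' x * lform x v
    <= e' * S.
  rewrite -sumrB /S mulr_sumr; apply: ler_sum => x _.
  rewrite (_ : _ - _ = (c x - c' x) * (kappa x * lform x v)); last by ring.
  rewrite (le_trans (ler_norm _)) // normrM ler_wpM2r // ltW //.
  by case: (c'P x).
have : e' * S < e by rewrite /e' mulrAC ltr_pdivrMr ?ltr_wpDl // ltr_pM2l //; lra.
lra.
Qed.

Lemma critical_closed : closed critical.
Proof.
rewrite -[critical]setCK; apply: open_closedC.
rewrite openE => g /noncritical_nbhs[v [d [d0 vd]]].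
apply/nbhs_ballP; exists d => // y; rewrite -ball_normE /= => gy [c cP c0].
have := vd c (fun x => ex_intro2 _ _ y gy (cP x)).
by rewrite sum_lform big1 ?ltxx // => i _; rewrite c0 mul0r.
Qed.

Lemma noncritical_descends g : ~ critical g ->
  exists v (d : R), 0 < d /\ forall y (t : R), 0 < t -> `|g - y| < d ->
    `|g - (y + t *: v)| < d -> energy (y + t *: v) < energy y.
Proof.
move=> /noncritical_nbhs[v [d [d0 vd]]]; exists v, d; split=> // y t t0 gy gyt.
(* Convexity bounds an increment from above by the subgradient at the far end and from below by the
   one at the start. The sign of [kappa x] decides which bound controls the weighted increment from
   above. *)
have /choice[c cP] : forall x, exists z,
    subdiff p (lform x (if 0 <= kappa x then y + t *: v else y)) z.
  by move=> x; exact: subdiff_nonempty.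
have /= vneg := vd c (fun x => ex_intro2 _ _
  (if 0 <= kappa x then y + t *: v else y)
  (match 0 <= kappa x as b return `|g - (if b then y + t *: v else y)| < d with
   | true => gyt | false => gy end) (cP x)).
rewrite -subr_lt0.
apply: (@le_lt_trans _ _ (p * t * \sum_x kappa x * c x * lform x v)).
  rewrite -sumrB mulr_sumr; apply: ler_sum => x _; rewrite -mulrBr.
  have := cP x; case: ifP => [k0|/negbT]; last rewrite -ltNge => k0.
    move=> /(subdiff_ineq p1 (lform x y)); rewrite lformD lformZ => h.
    rewrite (_ : p * t * _ = kappa x * (p * (c x * (t * lform x v)))); last by ring.
    rewrite ler_wpM2l //; move: h; rewrite opprD addrA subrr add0r mulrN; lra.
  move=> /(subdiff_ineq p1 (lform x (y + t *: v))); rewrite lformD lformZ => h.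
  rewrite (_ : p * t * _ = kappa x * (p * (c x * (t * lform x v)))); last by ring.
  rewrite ler_wnM2l ?(ltW k0) //; move: h.
  by rewrite [_ + _ - lform x y]addrAC subrr add0r; lra.
by rewrite pmulr_rlt0 // mulr_gt0 // (lt_le_trans _ p1).
Qed.

End Critical.

(** * The energy of a hypergraph *)

Section HypergraphEnergy.
Variables (R : realType) (n : nat) (G : orhypergraph n) (p lambda : R).
Hypothesis Gdeg : forall i : 'I_n, (0 < hdeg G i)%N.
Hypothesis p1 : 1 <= p.
Implicit Types (f g : 'rV[R]_n) (h : hyperedge n).

(** Vertices and hyperedges index one family of linear forms. All pairs of vertex sets occur, and
    [hweight] gives weight 0 to those that are not hyperedges. *)
Definition hcoef (x : 'I_n + hyperedge n) (j : 'I_n) : R :=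
  match x with inl i => (i == j)%:R | inr h => hsign R h j end.

Definition hweight (x : 'I_n + hyperedge n) : R :=
  match x with
  | inl i => - (lambda * (hdeg G i)%:R)
  | inr h => (h \in hedges G)%:R
  end.

Let E := energy hcoef hweight p.
Let crit := critical hcoef hweight p.

Lemma hedge_disjoint h i : h \in hedges G -> i \in h.1 -> i \in h.2 = false.
Proof.
move=> hG i1; apply/negP => i2.
by have := hedges_disjoint hG => /setP/(_ i); rewrite !inE i1 i2.
Qed.

Lemma lform_vertex i g : lform hcoef (inl i) g = g 0 i.
Proof.
rewrite /lform (bigD1 i) //= eqxx mul1r big1 ?addr0 // => j ji.
by rewrite eq_sym (negbTE ji) mul0r.
Qed.

Lemma lform_hedge h g : h \in hedges G -> lform hcoef (inr h) g = hpair h g.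
Proof.
move=> hG; rewrite /lform /hpair [X in X - _]big_mkcond [X in _ - X]big_mkcond /=.
rewrite -sumrB; apply: eq_bigr => i _; rewrite /hsign.
case: (boolP (i \in h.1)) => [i1|_].
  by rewrite (hedge_disjoint hG i1) mul1r subr0.
by case: (i \in h.2); rewrite ?mulN1r ?mul0r ?subr0 ?sub0r.
Qed.

Lemma energyE g : E g =
  \sum_(h in hedges G) `|hpair h g| `^ p
  - lambda * \sum_(i < n) (hdeg G i)%:R * `|g 0 i| `^ p.
Proof.
rewrite /E /energy big_sumType /= addrC; congr (_ + _).
  rewrite [RHS]big_mkcond /=; apply: eq_bigr => h _.
  by case: ifP => hG; rewrite ?mul0r // mul1r lform_hedge.
rewrite mulr_sumr -sumrN; apply: eq_bigr => i _.
by rewrite lform_vertex mulNr mulrA.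
Qed.

Lemma balanceE (c : 'I_n + hyperedge n -> R) j :
  \sum_x hweight x * c x * hcoef x j =
  \sum_(h in hedges G) hsign R h j * c (inr h)
  - lambda * (hdeg G j)%:R * c (inl j).
Proof.
rewrite big_sumType /= addrC; congr (_ + _).
  rewrite [RHS]big_mkcond /=; apply: eq_bigr => h _.
  by case: ifP => hG; rewrite ?mul0r // mul1r mulrC.
rewrite (bigD1 j) //= eqxx mulr1 mulNr big1 ?addr0 // => i /negbTE ->.
by rewrite mulr0.
Qed.

Lemma sum_hsign (w : hyperedge n -> R) i :
  \sum_(h in hedges G) hsign R h i * w h =
  \sum_(h in hedges G | i \in h.1) w h - \sum_(h in hedges G | i \in h.2) w h.
Proof.
rewrite !big_mkcondr -sumrB /=; apply: eq_bigr => h hG; rewrite /hsign.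
case: (boolP (i \in h.1)) => [i1|_].
  by rewrite (hedge_disjoint hG i1) mul1r subr0.
by case: (i \in h.2); rewrite ?mulN1r ?mul0r ?subr0 ?sub0r.
Qed.

Lemma pLaplacianE f i : (hdeg G i)%:R * pLaplacian G p f i =
  \sum_(h in hedges G) hsign R h i * dualpow p (hpair h f).
Proof.
rewrite /pLaplacian mulrA mulfV ?mul1r; last by rewrite pnatr_eq0 -lt0n Gdeg.
rewrite big_mkcondr /=; apply: eq_bigr => h _; rewrite finset.in_setU /hsign.
by case: (i \in h.1) => //; case: (i \in h.2) => //=; rewrite mul0r.
Qed.

(** By [balanceE] the critical equation is the eigenvalue equation multiplied by the degree, which
    is positive. For [p = 1] the subgradients are the [z i] and [w h] of [eigenpair1]. *)
Lemma eigenpair_critical f : eigenpair G p lambda f <-> f <> 0 /\ crit f.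
Proof.
rewrite /eigenpair; case: ifPn => [p1'|p1'].
  have sd t : subdiff p t = Sgn t by rewrite /subdiff p1'.
  split=> [[f0 [z [w [zP wP zw]]]]|[f0 [c cP c0]]]; split=> //.
    have /choice[u uP] : forall h, exists t, subdiff p (lform hcoef (inr h) f) t.
      by move=> h; exact: subdiff_nonempty.
    exists (fun x => match x with inl i => z i
      | inr h => if h \in hedges G then w h else u h end) => [[i|h]|i].
    - by rewrite sd lform_vertex.
    - by case: ifP => // hG; rewrite sd lform_hedge //; exact: wP.
    - rewrite balanceE -zw -sum_hsign; apply/eqP; rewrite subr_eq0; apply/eqP.
      by apply: eq_bigr => h ->.
  exists (fun i => c (inl i)), (fun h => c (inr h)); split.
  - by move=> i; have := cP (inl i); rewrite sd lform_vertex.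
  - by move=> h hG; have := cP (inr h); rewrite sd lform_hedge.
  - move=> i; rewrite -sum_hsign; apply/eqP; rewrite -subr_eq0; apply/eqP.
    by rewrite -balanceE.
have sd t : subdiff p t = [set dualpow p t] by rewrite /subdiff (negbTE p1').
split=> [[f0 fP]|[f0 [c cP c0]]]; split=> //.
  exists (fun x => dualpow p (lform hcoef x f)) => [x|i]; first by rewrite sd.
  rewrite balanceE lform_vertex -mulrA mulrCA -fP pLaplacianE.
  apply/eqP; rewrite subr_eq0; apply/eqP; apply: eq_bigr => h hG.
  by rewrite lform_hedge.
move=> i; have d0 : (hdeg G i)%:R != 0 :> R by rewrite pnatr_eq0 -lt0n Gdeg.
apply: (mulfI d0); rewrite pLaplacianE mulrCA mulrA.
have cE x : c x = dualpow p (lform hcoef x f) by have := cP x; rewrite sd.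
have := c0 i; rewrite balanceE cE lform_vertex => /eqP; rewrite subr_eq0 => /eqP <-.
by apply: eq_bigr => h hG; rewrite cE lform_hedge.
Qed.

Lemma hpair_continuous h : continuous (@hpair R n h).
Proof.
have c (A : {set 'I_n}) : continuous (fun g : 'rV[R]_n => \sum_(i in A) g 0 i).
  by apply: continuous_sumr => i; exact: coord_continuousr.
by move=> g; exact: (cvgB (c h.1 g) (c h.2 g)).
Qed.

Let den g := \sum_(i < n) (hdeg G i)%:R * `|g 0 i| `^ p.

Lemma RQ_den_gt0 g : g <> 0 -> 0 < den g.
Proof.
move=> g0; have [i gi] : exists i, g 0 i != 0.
  apply: contrapT => no; apply: g0; apply/rowP => i; rewrite mxE.
  by apply/eqP/negPn/negP => gi; apply: no; exists i.
rewrite /den (bigD1 i) //= ltr_wpDr //.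
  by apply: sumr_ge0 => j _; rewrite mulr_ge0 // powR_ge0.
by rewrite mulr_gt0 // ?ltr0n ?Gdeg // powR_gt0 // normr_gt0.
Qed.

Lemma RQ_lt g : E g < 0 -> RQ G p g < lambda.
Proof.
move=> Eg; have g0 : g <> 0.
  by move=> g0; move: Eg; rewrite g0 /E energy0 // ltxx.
by rewrite /RQ ltr_pdivrMr; [rewrite -subr_lt0 -energyE|exact: RQ_den_gt0].
Qed.

Lemma RQ_continuous g : g <> 0 -> {for g, continuous (RQ G p)}.
Proof.
move=> g0; have p0 : 0 < p by exact: lt_le_trans p1.
have cnum : continuous (fun g => \sum_(h in hedges G) `|hpair h g| `^ p).
  apply: continuous_sumr => h y.
  apply: (@continuous_comp _ _ _ (hpair h) (fun t : R => `|t| `^ p)).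
    exact: hpair_continuous.
  exact: normr_powR_continuous.
have cden : continuous den.
  apply: continuous_sumr => i y.
  have c : {for y, continuous (fun y : 'rV[R]_n => `|y 0 i| `^ p)}.
    apply: (@continuous_comp _ _ _ (fun y : 'rV[R]_n => y 0 i)
      (fun t : R => `|t| `^ p)).
      exact: coord_continuousr.
    exact: normr_powR_continuous.
  exact: (cvgM (cvg_cst _) c).
apply: (cvgM (cnum g) (cvgV _ (cden g))).
by rewrite gt_eqF // RQ_den_gt0.
Qed.

(** Otherwise [S] competes in the infimum. By compactness [RQ] attains its maximum on [S], at a
    point where it is below [lambda], so [minmax_eig] would be too. *)
Lemma negative_energy_genus_lt (k : nat) (S : set 'rV[R]_n) : (1 <= k)%N ->
  minmax_eig G p k = lambda%:E -> compact S -> csym S ->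
  (forall y, S y -> E y < 0) -> (genus S < k)%N.
Proof.
move=> k1 lk cS sS ES; rewrite ltnNge; apply/negP => kS.
have S0 y : S y -> y <> 0.
  by move=> /ES Ey y0; move: Ey; rewrite y0 /E energy0 // ltxx.
have [y1 Sy1] : S !=set0.
  apply/set0P/negP => /eqP Se; move: (leq_trans k1 kS).
  by rewrite /genus Se set0D asboolT.
have [|||y] := @EVT_max_rV R n (RQ G p) S; [by exists y1|exact: cS| |].
  by apply: continuous_in_subspaceT => y; rewrite inE => /S0; exact: RQ_continuous.
rewrite inE => Sy ymax.
have : (minmax_eig G p k <= (RQ G p y)%:E)%E.
  apply: (@le_trans _ _ (ereal_sup [set (RQ G p f)%:E | f in S `\ 0])).
    by apply: ereal_inf_lbound; exists S.
  apply: ge_ereal_sup => _ [z [Sz _] <-]; rewrite lee_fin.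
  by apply: ymax; rewrite inE.
by rewrite lk lee_fin leNgt RQ_lt // ES.
Qed.

(** * Linear combinations of the nodal pieces of [f] *)

Variable f : 'rV[R]_n.

Let m := #|nodal_domains G f|.
Let block (j : 'I_m) : {set 'I_n} := enum_val j.

Definition multiplier (b : 'rV[R]_m) (i : 'I_n) : R :=
  \sum_j b 0 j * (i \in block j)%:R.

Definition nodal_comb (b : 'rV[R]_m) : 'rV[R]_n :=
  \row_i (multiplier b i * f 0 i).

Lemma hadj_sym (H : {set hyperedge n}) : symmetric (hadj H).
Proof.
by move=> i j; apply/exists_inP/exists_inP => -[h hH hij]; exists h; rewrite // andbC.
Qed.

Lemma nodal_partition : finset.partition (nodal_domains G f) (vsupp f).
Proof.
apply: equivalence_partitionP => x y z _ _ _; split; first exact: connect0.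
move=> xy; apply/idP/idP; last exact: connect_trans.
by apply: connect_trans; rewrite (sym_connect_sym (@hadj_sym _)).
Qed.

Lemma multiplier_block j i b : i \in block j -> multiplier b i = b 0 j.
Proof.
move=> ij; rewrite /multiplier (bigD1 j) //= ij mulr1 big1 ?addr0 // => k kj.
rewrite (_ : i \in block k = false) ?mulr0 //; apply/negP => ik.
have /and3P[_ tr _] := nodal_partition; move: kj.
rewrite -(inj_eq enum_val_inj) => kj.
have := finset.trivIsetP tr _ _ (enum_valP k) (enum_valP j) kj.
by move=> /pred0P/(_ i); rewrite /= -/(block k) -/(block j) ik ij.
Qed.

Lemma supp_block i : f 0 i != 0 -> exists j, i \in block j.
Proof.
move=> fi; have /and3P[/eqP cov _ _] := nodal_partition.
have : i \in finset.cover (nodal_domains G f) by rewrite cov inE.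
move=> /finset.bigcupP[B BP iB]; exists (enum_rank_in BP B).
by rewrite /block enum_rankK_in.
Qed.

Lemma block_supp j : exists2 i, i \in block j & f 0 i != 0.
Proof.
have /imsetP[x xD bE] := enum_valP j; exists x; last by move: xD; rewrite inE.
by rewrite /block bE inE xD connect0.
Qed.

Lemma multiplier_hedge h i i' b : h \in hedges G -> f 0 i != 0 -> f 0 i' != 0 ->
  i \in h.1 :|: h.2 -> i' \in h.1 :|: h.2 -> multiplier b i = multiplier b i'.
Proof.
move=> hG fi fi' ih i'h; apply: eq_bigr => j _; congr (_ * _%:R).
have /imsetP[x _] := enum_valP j; rewrite -/(block j) => ->; rewrite !inE fi fi' /=.
have adj u v : f 0 u != 0 -> f 0 v != 0 -> u \in h.1 :|: h.2 ->
    v \in h.1 :|: h.2 -> fingraph.connect (hadj (restr_hedges G (vsupp f))) u v.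
  move=> fu fv uh vh; apply: connect1; apply/exists_inP.
  exists (h.1 :&: vsupp f, h.2 :&: vsupp f); first exact: imset_f.
  by move: uh vh; rewrite !inE /= fu fv !andbT => -> ->.
by congr nat_of_bool; apply/idP/idP => /connect_trans; apply; exact: adj.
Qed.

Lemma nodal_combN b : nodal_comb (- b) = - nodal_comb b.
Proof.
apply/rowP => i; rewrite !mxE -mulNr; congr (_ * _).
by rewrite /multiplier -sumrN; apply: eq_bigr => j _; rewrite mxE mulNr.
Qed.

Lemma nodal_comb_continuous : continuous nodal_comb.
Proof.
apply: continuous_rV => i.
rewrite (_ : (fun _ => _) = fun b => multiplier b i * f 0 i); last first.
  by apply/funext => b; rewrite mxE.
have cm : continuous (multiplier^~ i).
  apply: continuous_sumr => j b.
  exact: (cvgM (@coord_continuousr R _ j b) (cvg_cst _)).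
by move=> b; exact: (cvgM (cm b) (cvg_cst _)).
Qed.

Lemma nodal_comb_neq0 b : b <> 0 -> nodal_comb b <> 0.
Proof.
move=> b0 /rowP nb0; apply: b0; apply/rowP => j; rewrite mxE.
have [i ij fi] := block_supp j; have := nb0 i; rewrite !mxE.
rewrite (multiplier_block _ ij) => /eqP; rewrite mulf_eq0 (negbTE fi) orbF.
by move/eqP.
Qed.

(** A hyperedge meets at most one nodal domain, so a form of nonzero weight sees at most one
    coefficient of [b]. The first alternative covers vertices and hyperedges off the support. *)
Lemma lform_nodal_comb x : hweight x != 0 ->
  (lform hcoef x f = 0 /\ forall b, lform hcoef x (nodal_comb b) = 0) \/
  exists j, forall b, lform hcoef x (nodal_comb b) = b 0 j * lform hcoef x f.
Proof.
case: x => [i _|h /=].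
  have [fi0|fi] := eqVneq (f 0 i) 0.
    by left; rewrite lform_vertex; split=> // b; rewrite lform_vertex mxE fi0 mulr0.
  have [j ij] := supp_block fi; right; exists j => b.
  by rewrite !lform_vertex mxE (multiplier_block _ ij).
case: (boolP (h \in hedges G)) => [hG _|]; last by rewrite eqxx.
have hs0 i : i \notin h.1 :|: h.2 -> hsign R h i = 0.
  by rewrite finset.in_setU negb_or /hsign => /andP[/negbTE -> /negbTE ->].
have [/exists_inP[i ih fi]|none] := boolP [exists i in h.1 :|: h.2, f 0 i != 0].
  have [j ij] := supp_block fi; right; exists j => b.
  rewrite /lform mulr_sumr; apply: eq_bigr => i' _; rewrite mxE.
  have [i'h|/hs0 /= ->] := boolP (i' \in h.1 :|: h.2); last by rewrite !mul0r mulr0.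
  have [->|fi'] := eqVneq (f 0 i') 0; first by rewrite !mulr0.
  by rewrite (multiplier_hedge b hG fi' fi i'h ih) (multiplier_block _ ij) mulrCA.
have z i : hsign R h i * f 0 i = 0.
  have [ih|/hs0 ->] := boolP (i \in h.1 :|: h.2); last by rewrite mul0r.
  have [->|fi] := eqVneq (f 0 i) 0; first by rewrite mulr0.
  by case/negP: none; apply/exists_inP; exists i.
left; split=> [|b]; rewrite /lform big1 // => i _; first exact: z.
by rewrite mxE mulrCA z mulr0.
Qed.

(* Testing the eigenvalue equation against the combination of nodal pieces with
   coefficients [`|b_j| `^ p]. *)
Lemma energy_nodal_comb b : crit f -> E (nodal_comb b) = 0.
Proof.
move=> [c cP c0]; have p0 : p != 0 by rewrite gt_eqF // (lt_le_trans _ p1).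
pose b' : 'rV[R]_m := \row_j (`|b 0 j| `^ p).
transitivity (\sum_x hweight x * c x * lform hcoef x (nodal_comb b')).
  apply: eq_bigr => x _.
  have [->|wx] := eqVneq (hweight x) 0; first by rewrite !mul0r.
  rewrite -mulrA; congr (_ * _).
  have [[_ z]|[j jP]] := lform_nodal_comb wx; first by rewrite !z normr0 powR0 // mulr0.
  by rewrite !jP mxE mulrCA (subdiff_mul p1 (cP x)) normrM powRM.
by rewrite sum_lform big1 // => i _; rewrite c0 mul0r.
Qed.

End HypergraphEnergy.

(** * The bound on the number of nodal domains *)

Lemma within_continuous_precomp (T U W : topologicalType) (A : set T) (B : set U)
    (e : T -> U) (phi : U -> W) : {within B, continuous phi} -> continuous e ->
  (forall x, A x -> B (e x)) -> {within A, continuous (phi \o e)}.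
Proof.
move=> /subspace_continuousP cphi ce AB; apply/subspace_continuousP => x Ax.
move=> N /(cphi (e x) (AB x Ax)) /= Ne.
by apply: (@filterS _ (nbhs x) _ _ _ _ (ce x _ Ne)) => y h Ay; apply: h; exact: AB.
Qed.

Theorem theorem5p3 (R : realType) (n : nat) (G : orhypergraph n)
    (Gdeg : forall i : 'I_n, (0 < hdeg G i)%N) (p : R) (p1 : 1 <= p)
    (k r : nat) (k1 : (1 <= k)%N)
    (lambda : R) (lambda_k : minmax_eig G p k = lambda%:E)
    (f : 'rV[R]_n) (f_eig : eigenpair G p lambda f)
    (mult_r : multiplicity G p lambda = r) :
  (#|nodal_domains G f| <= k + r - 1)%N.
Proof.
rewrite leqNgt; apply/negP => km.
set m := #|nodal_domains G f| in km.
have [f0 fcrit] := (@eigenpair_critical R n G p lambda Gdeg f).1 f_eig.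
set E := energy (@hcoef R n) (hweight G lambda) p.
set crit := critical (@hcoef R n) (hweight G lambda) p in fcrit.
pose L := @nodal_comb R n G f.
have cL : continuous L by exact: nodal_comb_continuous.
have LN b : L (- b) = - L b by exact: nodal_combN.
have EL b : E (L b) = 0 by exact: energy_nodal_comb.
pose O := @cross_sphere R m.
have O0 b : O b -> b <> 0.
  move=> + b0; rewrite b0 /O /cross_sphere /= big1 => [/esym/eqP|i _].
    by rewrite oner_eq0.
  by rewrite mxE normr0.
have L0 b : O b -> L b <> 0 by move=> /O0; exact: nodal_comb_neq0.
have eigL b : O b -> crit (L b) -> (eigenfunctions G p lambda `\ 0) (L b).
  move=> Ob cb; split; last exact: L0.
  by apply/(@eigenpair_critical R n G p lambda Gdeg); split=> //; exact: L0.
have clO : closed O.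
  apply: compact_closed; [exact: norm_hausdorff|exact: cross_sphere_compact].
have [phi [cphi oddphi sphi]] := has_odd_map_genus (eigenfunctions G p lambda).
(* The coefficient vectors whose combination is an eigenfunction; the genus map of the
   eigenfunctions is pulled back here and then extended. *)
pose A := O `&` L @^-1` crit.
have AE b : A b -> (eigenfunctions G p lambda `\ 0) (L b).
  by case=> Ob; exact: eigL.
have [|||||phit [cphit oddphit phitA]] := @odd_extension R m _ A (phi \o L).
- apply: closedI => //; apply: preimage_closed; first by move=> b _; exact: cL.
  exact: critical_closed.
- exact: within_continuous_precomp cphi cL AE.
- by move=> b [Ob cb]; split; [exact: cross_sphereN|rewrite /= LN; exact: criticalN].
- by move=> b /AE Eb /=; rewrite LN oddphi.
- by move=> b /AE Eb /=; exact: esphere_norm (sphi _ Eb).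
pose D := O `&` [set b | phit b = 0].
have cD : compact D.
  apply: compact_closedI; first exact: cross_sphere_compact.
  rewrite (_ : [set _ | _] = (fun b => `|phit b|) @^-1` [set t | t = 0]).
    apply: preimage_closed; last exact: closed_eq.
    by move=> b _; apply: continuous_comp; [exact: cphit|exact: norm_continuous].
  by apply/seteqP; split=> b /= => [->|/normr0_eq0 //]; exact: normr0.
have DN b : D b -> D (- b).
  by move=> [Ob pb]; split; [exact: cross_sphereN|rewrite /= oddphit pb oppr0].
have ncD b : D b -> ~ crit (L b).
  move=> [Ob pb] cb; have Ab : A b by [].
  by apply: (esphere_neq0 (sphi _ (AE b Ab))); rewrite -pb phitA.
have [|||eta [ceta oddeta etaE]] := @odd_descent R _ E (L @` D).
- by apply: continuous_compact => //; exact: continuous_subspaceT.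
- exact: energyN.
- move=> _ [b Db <-]; have [v [d [d0 vd]]] := noncritical_descends p1 (ncD b Db).
  by exists (L b, v, d).
pose S := (eta \o L) @` D.
have cetaL : continuous (eta \o L).
  by move=> b; apply: continuous_comp; [exact: cL|exact: ceta].
have ES y : S y -> E y < 0.
  by move=> [b Db <-]; rewrite -(EL b); apply: etaE; exists b.
have gS : (genus S < k)%N.
  apply: (negative_energy_genus_lt Gdeg p1 k1 lambda_k _ _ ES).
    by apply: continuous_compact; [exact: continuous_subspaceT|exact: cD].
  by move=> _ [b Db <-]; exists (- b); [exact: DN|rewrite /= LN oddeta].
have S0 y : S y -> (S `\ 0) y.
  by move=> Sy; split=> // y0; have := ES _ Sy; rewrite y0 /E energy0 // ltxx.
have DS b : D b -> (S `\ 0) (eta (L b)) by move=> Db; apply: S0; exists b.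
have [psi [cpsi oddpsi spsi]] := has_odd_map_genus S.
have [|||||psit [cpsit oddpsit psitD]] :=
  @odd_extension R m _ D (psi \o (eta \o L)).
- by apply: compact_closed => //; exact: norm_hausdorff.
- exact: within_continuous_precomp cpsi cetaL DS.
- exact: DN.
- by move=> b /DS Sb /=; rewrite LN oddeta oddpsi.
- by move=> b /DS Sb /=; exact: esphere_norm (spsi _ Sb).
(* The assumption to refute is [k + r - 1 < m], and [genus S] is at most [k - 1]. *)
have rjm : (genus (eigenfunctions G p lambda) + genus S < m)%N.
  rewrite -/(multiplicity G p lambda) mult_r.
  apply: leq_ltn_trans km; rewrite -addnBAC // addnC leq_add2r.
  by rewrite -ltnS subn1 prednK.
have [||b Ob] := @borsuk_ulam R m _ (fun b => row_mx (phit b) (psit b)) rjm.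
- apply: continuous_rV => i.
  have [u ->|u ->] := split_ordP i.
    rewrite (_ : (fun _ => _) = fun b => phit b 0 u); last first.
      by apply/funext => b; rewrite row_mxEl.
    move=> b; apply: (@continuous_comp _ _ _ phit (fun y : 'rV_ _ => y 0 u)).
      exact: cphit.
    exact: coord_continuousr.
  rewrite (_ : (fun _ => _) = fun b => psit b 0 u); last first.
    by apply/funext => b; rewrite row_mxEr.
  move=> b; apply: (@continuous_comp _ _ _ psit (fun y : 'rV_ _ => y 0 u)).
      exact: cpsit.
    exact: coord_continuousr.
- by move=> b _; rewrite oddphit oddpsit opp_row_mx.
(* The zero of [phit] puts [b] in [D], where [psit] has unit values and cannot vanish. *)
rewrite -row_mx0 => /eq_row_mx[pb qb].
have Db : D b by [].
by apply: (esphere_neq0 (spsi _ (DS b Db))); rewrite -qb psitD.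
Qed.
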